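(* Assume (A1), (A2$_\nu$) and (A3). Run the coordinate-wise variant of ZO-Varag (described in the context) with the strong convexity parameter $\tau$ of (A3). Let $s_0:=\lfloor\log_2 n\rfloor+1$ and set $T_s=2^{s-1}$ for $s\le s_0$, $T_s=T_{s_0}$ for $s>s_0$; $\gamma_s=\frac1{12L\alpha_s}$; $p_s=\frac12$; $\alpha_s=\frac12$ for $s\le s_0$ and $\alpha_s=\min\{\sqrt{\frac{n\tau}{12L}},\frac12\}$ for $s>s_0$. For $1\le s\le s_0$ set $\theta_t=\frac{\gamma_s}{\alpha_s}(\alpha_s+p_s)$ for $1\le t\le T_s-1$ and $\theta_{T_s}=\frac{\gamma_s}{\alpha_s}$; for $s>s_0$ set $\theta_t=\Gamma_{t-1}-(1-\alpha_s-p_s)\Gamma_t$ for $1\le t\le T_s-1$ and $\theta_{T_s}=\Gamma_{T_s-1}$, with $\Gamma_t=(1+\tau\gamma_s)^t$. Then $$\mathbb E[f(\tilde x^s)-f^*]\le\begin{cases}\frac{1}{2^{s+1}}D_0'+1.5\varsigma_1+4\varsigma_2, & 1\le s\le s_0,\\ (4/5)^{s-s_0}\frac{D_0'}{n}+9\varsigma_1+24\varsigma_2, & s>s_0\text{ and }n\ge\frac{3L}{\tau},\\ \big(1+\frac14\sqrt{\frac{n\tau}{3L}}\big)^{-(s-s_0)}\frac{D_0'}{n}+\big(2\sqrt{\frac{3L}{n\tau}}+1\big)(3\varsigma_1+8\varsigma_2), & s>s_0\text{ and }n<\frac{3L}{\tau},\end{cases}$$ where $\varsigma_1=\nu^2Ld$,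 $\varsigma_2=L\sqrt dZ\nu$, and $D_0':=2[f(x^0)-f(x^* )]+6L\|x^0-x^*\|^2$.
   Context: Problem: minimize $f(x)=\frac1n\sum_{i=1}^n f_i(x)$ over $x\in\mathbb R^d$ using only function values; $f^*=\min f$, $x^*$ the minimizer. Assumption (A1): each $f_i$ is convex, differentiable and $L$-smooth. Assumption (A3): $f$ is $\tau$-strongly convex with $\tau>0$. Estimator: $g_\nu(x,i)=\sum_{j=1}^d\frac{f_i(x+\nu e_j)-f_i(x-\nu e_j)}{2\nu}e_j$ ($\nu>0$, $e_j$ standard basis), $g_\nu(x)=\frac1n\sum_ig_\nu(x,i)$. Assumption (A2$_\nu$): there is a finite $Z$ (possibly depending on $L,d$) such that, for $\nu$ small enough, $\sup_{s\ge0}\max_{x\in\{\bar x_t\}\cup\{\underline x_t\}}\mathbb E\|x-x^*\|\le Z$ over the inner-loop iterates of each epoch of the algorithm below. Coordinate-wise ZO-Varag (inputs $x^0$, $\tau$, $\{T_s\},\{\gamma_s\},\{\alpha_s\},\{p_s\},\{\theta_t\}$): $\tilde x^0=\bar x^0=x^0$. For $s=1,2,\dots$: $\tilde x=\tilde x^{s-1}$, $x_0=x^{s-1}$, $\bar x_0=\tilde x$, $\tilde g^s=g_\nu(\tilde x)$; for $t=1,\dots,T_s$: $\underline x_t=\big[(1+\tau\gamma_s)(1-\alpha_s-p_s)\bar x_{t-1}+\alpha_sx_{t-1}+(1+\tau\gamma_s)p_s\tilde x\big]/[1+\tau\gamma_s(1-\alpha_s)]$; draw $i_t$ uniform on $\{1,\dots,n\}$;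 $G_t=g_\nu(\underline x_t,i_t)-g_\nu(\tilde x,i_t)+\tilde g^s$; $x_t=[\gamma_sG_t+\gamma_s\tau\underline x_t+x_{t-1}]/(1+\gamma_s\tau)$; $\bar x_t=(1-\alpha_s-p_s)\bar x_{t-1}+\alpha_sx_t+p_s\tilde x$. Then $x^s=x_{T_s}$, $\tilde x^s=\sum_t\theta_t\bar x_t/\sum_t\theta_t$.
   Formalization: The update is taken as x_t=[x_{t-1}+γ_sτ x̲_t−γ_sG_t]/(1+γ_sτ), with −γ_sG_t instead of the printed +γ_sG_t, since with the plus sign the method ascends and its iterates diverge (e.g. n=d=1, f(x)=Lx²/2, x⁰≠0). *)

(* Defs.v *)
From HB Require Import structures.
From mathcomp Require Import all_boot all_order all_algebra.
From mathcomp Require Import all_classical all_reals all_analysis.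
Set Implicit Arguments. Unset Strict Implicit. Unset Printing Implicit Defensive.
Import Order.TTheory GRing.Theory Num.Theory.
Import numFieldNormedType.Exports.
Local Open Scope ring_scope.

Section ZOVarag.
Variable R : realType.
Variable d : nat.
Local Notation vec := 'rV[R]_d.

Definition dotv (u v : vec) : R := \sum_(j < d) u 0 j * v 0 j.
Definition enorm (u : vec) : R := Num.sqrt (dotv u u).
Definition ej (j : 'I_d) : vec := delta_mx 0 j.
Definition grad (g : vec -> R) (x : vec) : vec := \row_j ('d g x (ej j)).

Definition convex_fun (g : vec -> R) : Prop :=
  forall (x y : vec) (l : R), 0 <= l <= 1 ->
    g (l *: x + (1 - l) *: y) <= l * g x + (1 - l) * g y.

Definition strongly_convex (tau : R) (g : vec -> R) : Prop :=
  forall (x y : vec) (l : R), 0 <= l <= 1 ->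
    g (l *: x + (1 - l) *: y)
      <= l * g x + (1 - l) * g y - tau / 2 * l * (1 - l) * enorm (x - y) ^+ 2.

Definition A1_comp (L : R) (g : vec -> R) : Prop :=
  convex_fun g /\ (forall x, differentiable g x) /\
  (forall x y, enorm (grad g x - grad g y) <= L * enorm (x - y)).

Variable n : nat.
Variable f : nat -> vec -> R.

Definition fbar (x : vec) : R := n%:R^-1 * \sum_(i < n) f i x.

Variable nu : R.
Definition gnu_i (i : nat) (x : vec) : vec :=
  \row_j ((f i (x + nu *: ej j) - f i (x - nu *: ej j)) / (2 * nu)).
Definition gnu (x : vec) : vec := n%:R^-1 *: \sum_(i < n) gnu_i i x.

(* expectation over K i.i.d. uniform indices in {0,..,n-1}: the stream w
   gives the index drawn at global draw number k (k = 0,1,...). *)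
Definition Exp (K : nat) (F : (nat -> nat) -> R) : R :=
  (n%:R ^+ K)^-1 * \sum_(w : K.-tuple 'I_n) F (fun k => nth 0%N (map val w) k).

Variable tau : R.
Section Inner.
Variables (g a p : R) (xt gt : vec).
(* state = (x_{t-1}, xbar_{t-1}) *)
Definition xlow (st : vec * vec) : vec :=
  (1 + tau * g * (1 - a))^-1 *:
    ((1 + tau * g) * (1 - a - p) *: st.2 + a *: st.1 + (1 + tau * g) * p *: xt).
Definition istep (st : vec * vec) (i : nat) : vec * vec :=
  let xl := xlow st in
  let G := gnu_i i xl - gnu_i i xt + gt in
  let x' := (1 + g * tau)^-1 *: (st.1 + g * tau *: xl - g *: G) in
  (x', (1 - a - p) *: st.2 + a *: x' + p *: xt).
(* inner k = (x_k, xbar_k); idx k = index i_{k+1} *)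
Fixpoint inner (x0 : vec) (idx : nat -> nat) (k : nat) : vec * vec :=
  match k with
  | 0 => (x0, xt)
  | k'.+1 => istep (inner x0 idx k') (idx k')
  end.
End Inner.

Variables (T : nat -> nat) (gam alp ps : nat -> R) (th : nat -> nat -> R).
Variable x0 : vec.

Definition draws (s : nat) : nat := \sum_(1 <= k < s.+1) T k.

(* inner state (x_t, xbar_t) of epoch s, given (x^{s-1}, xtilde^{s-1}) *)
Definition run_epoch (s : nat) (prev : vec * vec) (w : nat -> nat) (t : nat)
  : vec * vec :=
  inner (gam s) (alp s) (ps s) prev.2 (gnu prev.2) prev.1
        (fun k => w (draws s.-1 + k)) t.

(* outer w s = (x^s, xtilde^s) *)
Fixpoint outer (w : nat -> nat) (s : nat) : vec * vec :=
  match s with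
  | 0 => (x0, x0)
  | s'.+1 =>
      let prev := outer w s' in
      let st := run_epoch s'.+1 prev w in
      ((st (T s'.+1)).1,
       (\sum_(1 <= t < (T s'.+1).+1) th s'.+1 t)^-1 *:
         \sum_(1 <= t < (T s'.+1).+1) th s'.+1 t *: (st t).2)
  end.

Definition xbar_it (w : nat -> nat) (s t : nat) : vec :=
  (run_epoch s (outer w s.-1) w t).2.
Definition xlow_it (w : nat -> nat) (s t : nat) : vec :=
  xlow (gam s) (alp s) (ps s) (outer w s.-1).2 (run_epoch s (outer w s.-1) w t.-1).

End ZOVarag.

Section Schedule.
Variable R : realType.
Variables (n : nat) (L tau : R).

Definition s0 : nat := (trunc_log 2 n).+1.
Definition Tsch (s : nat) : nat :=
  if (s <= s0)%N then (2 ^ s.-1)%N else (2 ^ s0.-1)%N.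
Definition alpsch (s : nat) : R :=
  if (s <= s0)%N then 1 / 2
  else Num.min (Num.sqrt (n%:R * tau / (12 * L))) (1 / 2).
Definition gamsch (s : nat) : R := 1 / (12 * L * alpsch s).
Definition psch (s : nat) : R := 1 / 2.
Definition thsch (s t : nat) : R :=
  let a := alpsch s in let g := gamsch s in let p := psch s in
  if (s <= s0)%N then
    (if (t < Tsch s)%N then g / a * (a + p) else g / a)
  else
    let Gam := fun k : nat => (1 + tau * g) ^+ k in
    (if (t < Tsch s)%N then Gam t.-1 - (1 - a - p) * Gam t
     else Gam (Tsch s).-1).
End Schedule.

Definition zv_outer (R : realType) (d n : nat) (f : nat -> 'rV[R]_d -> R)
  (nu L tau : R) (x0 : 'rV[R]_d) (w : nat -> nat) (s : nat) :=
  outer n f nu tau (Tsch n) (gamsch n L tau) (alpsch n L tau) (psch R) (thsch n L tau) x0 w s.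
Definition zv_xbar (R : realType) (d n : nat) (f : nat -> 'rV[R]_d -> R)
  (nu L tau : R) (x0 : 'rV[R]_d) (w : nat -> nat) (s t : nat) :=
  xbar_it n f nu tau (Tsch n) (gamsch n L tau) (alpsch n L tau) (psch R) (thsch n L tau) x0 w s t.
Definition zv_xlow (R : realType) (d n : nat) (f : nat -> 'rV[R]_d -> R)
  (nu L tau : R) (x0 : 'rV[R]_d) (w : nat -> nat) (s t : nat) :=
  xlow_it n f nu tau (Tsch n) (gamsch n L tau) (alpsch n L tau) (psch R) (thsch n L tau) x0 w s t.

(* Main.v *)
Require Import Defs.
From HB Require Import structures.
From mathcomp Require Import all_boot all_order all_algebra.
From mathcomp Require Import all_classical all_reals all_analysis.
From mathcomp Require Import ring lra.
Import Order.TTheory GRing.Theory Num.Theory.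
Import numFieldNormedType.Exports.
Local Open Scope ring_scope.

(** One inner step, averaged over the drawn index and with c = 6 L alpha^2,
    satisfies
      E[F(xbar_t)] + c (1 + tau gamma) E|x_t - x^*|^2
        <= (1/2 - alpha) F(xbar_(t-1)) + F(xtilde) / 2 + c |x_(t-1) - x^*|^2 + e,
    where F is the optimality gap and e collects the finite-difference errors.
    The deviation of G_t from the gradient at the middle point costs at most its
    second moment over 12 L; by cocoercivity that moment is 4 L times the Bregman
    divergence from the middle point to xtilde, plus errors of order (L nu)^2 d,
    and the divergence is absorbed by the weight p = 1/2 of xtilde.  The bias of
    g_nu, of norm at most L nu sqrt d / 2, is paired with points whose expected
    distance to x^* is at most Z.  Weighting step t by (1 + tau gamma)^(t-1)
    telescopes over an epoch.  Early epochs then give a doubling recursion, and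
    late ones contract by 1 + alpha / 2; both late regimes of the theorem are this
    one estimate, for the two values of the minimum defining alpha. *)

(** * Euclidean geometry and smooth functions *)

Section Euclidean.
Context {R : realType} {d : nat}.
Implicit Types (u v w : 'rV[R]_d) (k c : R).

Lemma dotvC u v : dotv u v = dotv v u.
Proof. by apply: eq_bigr => j _; rewrite mulrC. Qed.

Lemma dotvDl u v w : dotv (u + v) w = dotv u w + dotv v w.
Proof. by rewrite -big_split /=; apply: eq_bigr => j _; rewrite mxE mulrDl. Qed.

Lemma dotvZl k u w : dotv (k *: u) w = k * dotv u w.
Proof. by rewrite /dotv big_distrr /=; apply: eq_bigr => j _; rewrite mxE mulrA. Qed.

Lemma dotvNl u w : dotv (- u) w = - dotv u w.
Proof. by rewrite -scaleN1r dotvZl mulN1r. Qed.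

Lemma dotvDr u v w : dotv w (u + v) = dotv w u + dotv w v.
Proof. by rewrite !(dotvC w) dotvDl. Qed.

Lemma dotvZr k u w : dotv w (k *: u) = k * dotv w u.
Proof. by rewrite !(dotvC w) dotvZl. Qed.

Lemma dotvNr u w : dotv w (- u) = - dotv w u.
Proof. by rewrite !(dotvC w) dotvNl. Qed.

Definition dotvE := (dotvDl, dotvDr, dotvZl, dotvZr, dotvNl, dotvNr).

Lemma dotv0r u : dotv u 0 = 0.
Proof. by apply: big1 => j _; rewrite mxE mulr0. Qed.

Lemma dotv_suml I (r : seq I) (F : I -> 'rV[R]_d) w :
  dotv (\sum_(i <- r) F i) w = \sum_(i <- r) dotv (F i) w.
Proof.
elim/big_rec2: _ => [|i x y _ <-]; last exact: dotvDl.
by rewrite dotvC dotv0r.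
Qed.

Lemma dotv_ge0 u : 0 <= dotv u u.
Proof. by apply: sumr_ge0 => j _; rewrite -expr2 sqr_ge0. Qed.

Lemma enorm_ge0 u : 0 <= enorm u.
Proof. exact: sqrtr_ge0. Qed.

Lemma enorm_sq u : enorm u ^+ 2 = dotv u u.
Proof. by rewrite /enorm sqr_sqrtr // dotv_ge0. Qed.

Lemma dotv_ej u (j : 'I_d) : dotv u (ej R j) = u 0 j.
Proof.
rewrite /dotv (bigD1 j) //= big1 ?addr0 => [|i ij].
  by rewrite mxE !eqxx mulr1.
by rewrite mxE (negPf ij) andbF mulr0.
Qed.

(** Cauchy-Schwarz: expand the square of [dotv u u *: v - dotv u v *: u], a multiple of the part of
    [v] orthogonal to [u], then cancel a factor [dotv u u]. That cancellation is why [u = 0] is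
    treated apart. *)
Lemma dotv_sqr_le u v : dotv u v ^+ 2 <= dotv u u * dotv v v.
Proof.
have := dotv_ge0 u; rewrite le_eqVlt => /orP[/eqP u0|u_gt0].
  have uj j : u 0 j = 0.
    apply/eqP; rewrite -sqrf_eq0 eq_le sqr_ge0 andbT u0 /dotv (bigD1 j) //=.
    by rewrite -expr2 lerDl sumr_ge0 // => i _; rewrite -expr2 sqr_ge0.
  have -> : dotv u v = 0 by apply: big1 => j _; rewrite uj mul0r.
  by rewrite -u0 mul0r expr0n.
have := dotv_ge0 (dotv u u *: v - dotv u v *: u).
rewrite !dotvE (dotvC v u) => h.
rewrite -(ler_pM2l u_gt0); nra.
Qed.

Lemma dotv_le u v : dotv u v <= enorm u * enorm v.
Proof.
apply: le_trans (ler_norm _) _.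
rewrite -(ler_pXn2r (n := 2)) // ?nnegrE ?normr_ge0 //; last first.
  by rewrite mulr_ge0 // enorm_ge0.
by rewrite -normrX ger0_norm ?sqr_ge0 // exprMn !enorm_sq dotv_sqr_le.
Qed.

Lemma dotv_le_norm u v c : 0 <= c -> dotv u u <= c ^+ 2 ->
  dotv u v <= c * enorm v.
Proof.
move=> c0 uc; apply: le_trans (dotv_le u v) _; apply: ler_wpM2r (enorm_ge0 v) _ _ _.
by rewrite -(ler_pXn2r (n := 2)) ?nnegrE ?enorm_ge0 // enorm_sq.
Qed.

Lemma enormB u v : enorm (u - v) = enorm (v - u).
Proof. by rewrite /enorm -(opprB v u) dotvNl dotvNr opprK. Qed.

End Euclidean.

(** * Two-sided quadratic bound for smooth functions *)

Section Smooth.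
Context {R : realType} {d : nat}.
Implicit Types (x y u : 'rV[R]_d) (L : R).
Variables (L : R) (g : 'rV[R]_d -> R).
Hypothesis gA1 : A1_comp L g.

Lemma diff_dotv x u : 'd g x u = dotv (grad g x) u.
Proof.
rewrite [in LHS](row_sum_delta u) linear_sum; apply: eq_bigr => j _.
by rewrite linearZ mxE mulrC.
Qed.

Lemma is_derive_line x u (t : R) :
  is_derive t 1 (fun t : R => g (x + t *: u)) (dotv (grad g (x + t *: u)) u).
Proof.
have [_ [dg _]] := gA1.
have h : derivable g (x + t *: u) u by exact: diff_derivable.
(* In place of a chain rule: the difference quotient in [t] is, term by term, the directional
   quotient of [g] at [x + t *: u]. *)
have e : (fun h : R => h^-1 *: (g (x + (h *: (1 : R) + t) *: u) - g (x + t *: u)))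
       = (fun h => h^-1 *: (g (h *: u + (x + t *: u)) - g (x + t *: u))).
  apply/funext => k; congr (_ *: (g _ - _)).
  by rewrite scalerDl addrCA [k *: 1]mulr1.
split; first by move: h; rewrite /derivable /= e.
by rewrite -diff_dotv -deriveE // /derive /= e.
Qed.

(** Mean value theorem on the segment, without integration. A quadratic with free coefficient [k] is
    subtracted first; the theorem applied to [g] alone would give [L] instead of [L / 2]. *)
Lemma smooth_bound x y :
  `|g y - g x - dotv (grad g x) (y - x)| <= L / 2 * dotv (y - x) (y - x).
Proof.
have [_ [_ lip]] := gA1.
set u := y - x; set q := dotv u u; set s := dotv _ u.
have mvt (k : R) : exists2 c : R, 0 <= c &
    g y - g x - s - k / 2 * q = dotv (grad g (x + c *: u)) u - s - k * c * q.
  pose psi t : R := g (x + t *: u) - t * s - t ^+ 2 * (k / 2 * q).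
  pose dpsi t : R := dotv (grad g (x + t *: u)) u - s - 2 * t * (k / 2 * q).
  have dpsiP t : is_derive t (1 : R) psi (dpsi t).
    have h := is_derive_line x u t.
    (* The subtracted part is written as a polynomial so that its derivative is the formal one. *)
    pose P : {poly R} := s *: 'X + (k / 2 * q) *: 'X^2.
    have hP := is_derive_poly P t.
    have -> : psi = (fun t => g (x + t *: u)) - horner P.
      by apply/funext => z; rewrite /psi /P !fctE hornerD !hornerZ hornerX hornerXn; ring.
    have -> : dpsi t = dotv (grad g (x + t *: u)) u - P^`().[t].
      rewrite /dpsi /P derivD !derivZ derivX derivXn /= hornerD !hornerZ
        hornerMn hornerX -polyC1 hornerC; ring.
    exact: is_deriveB.
  have psic : {within `[0, 1], continuous psi}%classic.
    apply: continuous_subspaceT => t.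
    exact/differentiable_continuous/derivable1_diffP.
  have [c /itvP cI e] := MVT_segment ler01 (fun t _ => dpsiP t) psic.
  exists c; first by rewrite cI.
  move: e; rewrite /psi /dpsi scale1r scale0r addr0 [x + u]addrC subrK.
  clearbody q s; move: (dotv _ u) (g y) (g x) => w gy gx; lra.
have lipc c : 0 <= c -> `|dotv (grad g (x + c *: u)) u - s| <= L * c * q.
  move=> c0; rewrite -[_ - s]/(_ + - dotv _ _) -dotvNl -dotvDl.
  have nb w : dotv w u <= enorm w * enorm u by exact: dotv_le.
  have := lip (x + c *: u) x; rewrite [x + _]addrC addrK.
  set w := _ - grad g x => hw.
  have e : enorm (c *: u) = c * enorm u.
    by rewrite /enorm dotvZl dotvZr mulrA -expr2 sqrtrM ?sqr_ge0 // sqrtr_sqr ger0_norm.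
  have le1 : enorm w * enorm u <= L * c * q.
    rewrite /q -enorm_sq expr2 mulrA; apply: ler_wpM2r; first exact: enorm_ge0.
    by rewrite -mulrA -e.
  have enN : enorm (- w) = enorm w by rewrite /enorm dotvNl dotvNr opprK.
  rewrite ler_norml; apply/andP; split.
    have := nb (- w); rewrite dotvNl enN; lra.
  have := nb w; lra.
have {mvt lipc} key k : exists c w, [/\ `|w| <= L * c * q &
    g y - g x - s - k / 2 * q = w - k * c * q].
  have [c c0 e] := mvt k.
  by exists c, (dotv (grad g (x + c *: u)) u - s); split; [exact: lipc|].
(* [k = L] gives the upper bound and [k = - L] the lower one: in both, [L * c * q] dominates [w],
   whatever the mean value point [c] is. *)
clearbody q s; have [c1 [w1 [/ler_normlP [_ h1] e1]]] := key L.
have [c2 [w2 [/ler_normlP [h2 _] e2]]] := key (- L).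
by rewrite ler_norml; apply/andP; split; lra.
Qed.

End Smooth.

(** * Averages over the components, and second moments *)

Section Average.
Context {R : realType} (n : nat).
Hypothesis n_gt0 : (0 < n)%N.
Implicit Types (F G : nat -> R).

Definition avg F : R := n%:R^-1 * \sum_(i < n) F i.

Lemma avgD F G : avg (fun i => F i + G i) = avg F + avg G.
Proof. by rewrite /avg big_split mulrDr. Qed.

Lemma avgZ k F : avg (fun i => k * F i) = k * avg F.
Proof. by rewrite /avg -big_distrr /= mulrCA. Qed.

Lemma avg_cst k : avg (fun=> k) = k.
Proof.
rewrite /avg sumr_const card_ord -[X in _ * X]mulr_natl mulKf //.
by rewrite pnatr_eq0 -lt0n.
Qed.

Lemma ler_avg F G : (forall i, (i < n)%N -> F i <= G i) -> avg F <= avg G.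
Proof.
by move=> FG; rewrite ler_wpM2l ?invr_ge0 ?ler0n // ler_sum // => i _; exact: FG.
Qed.

Lemma dotv_vavg d (F : nat -> 'rV[R]_d) w :
  dotv (n%:R^-1 *: \sum_(i < n) F i) w = avg (fun i => dotv (F i) w).
Proof. by rewrite dotvZl dotv_suml. Qed.

(** Jensen for the squared norm, obtained by averaging [0 <= dotv (F i - m) (F i - m)]. *)
Lemma vavg_sq_le d (F : nat -> 'rV[R]_d) m :
  m = n%:R^-1 *: \sum_(i < n) F i ->
  dotv m m <= avg (fun i => dotv (F i) (F i)).
Proof.
move=> mE; have em : dotv m m = avg (fun i => dotv (F i) m) by rewrite {1}mE dotv_vavg.
have : avg (fun i => 2 * dotv (F i) m + - 1 * dotv m m) <= avg (fun i => dotv (F i) (F i)).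
  apply: ler_avg => i _; have := dotv_ge0 (F i - m).
  rewrite !dotvE (dotvC m); lra.
rewrite avgD !avgZ avg_cst -em; lra.
Qed.

(** The centred second moment is the raw one minus [dotv m m]. *)
Lemma variance_le d (F : nat -> 'rV[R]_d) m :
  m = n%:R^-1 *: \sum_(i < n) F i ->
  avg (fun i => dotv (F i - m) (F i - m)) <= avg (fun i => dotv (F i) (F i)).
Proof.
move=> mE; have em : dotv m m = avg (fun i => dotv (F i) m) by rewrite {1}mE dotv_vavg.
have -> : avg (fun i => dotv (F i - m) (F i - m)) =
    avg (fun i => dotv (F i) (F i) + (- 2 * dotv (F i) m + dotv m m)).
  congr (_ * _); apply: eq_bigr => i _.
  rewrite !dotvE (dotvC m); ring.
rewrite !avgD avgZ avg_cst -em; have := dotv_ge0 m; lra.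
Qed.

End Average.

(** * First-order inequalities and the finite-difference error *)

Section Gradients.
Context {R : realType} {d : nat}.
Implicit Types (x y v : 'rV[R]_d).

(* Letting the weight of the strong convexity inequality tend to 0; the
   quadratic bound plays the role of differentiability at x. *)
Lemma gradient_inequality (g : 'rV[R]_d -> R) v x y (M tau : R) :
  (forall z, `|g z - g x - dotv v (z - x)| <= M * dotv (z - x) (z - x)) ->
  strongly_convex tau g ->
  g x + dotv v (y - x) + tau / 2 * dotv (y - x) (y - x) <= g y.
Proof.
move=> quad sc; set u := y - x; set q := dotv u u.
have key (l : R) : 0 < l -> l <= 1 ->
    dotv v u + tau / 2 * q - (g y - g x) <= l * ((M + tau / 2) * q).
  move=> l0 l1; have l01 : 0 <= l <= 1 by rewrite ltW.
  have := sc y x l l01; rewrite enorm_sq -/u -/q.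
  have -> : l *: y + (1 - l) *: x = x + l *: u.
    by apply/rowP => j; rewrite !mxE; ring.
  have /ler_normlP [+ _] := quad (x + l *: u).
  rewrite [x + _]addrC addrK !dotvZl !dotvZr -/q => h1 h2.
  rewrite -(ler_pM2l l0); lra.
rewrite leNgt; apply/negP => h.
(* [D] is the supposed violation and [B] the coefficient of the vanishing error. The weight
   [D / (D + |B|)] lies in (0, 1] and is small enough to contradict [key]. *)
set D := dotv v u + tau / 2 * q - (g y - g x) in key.
have D0 : 0 < D by rewrite /D; lra.
set B := (M + tau / 2) * q in key.
have B0 := normr_ge0 B; have BB := ler_norm B.
have s0 : 0 < D + `|B| by lra.
have l0 : 0 < D / (D + `|B|) by rewrite divr_gt0.
have l1 : D / (D + `|B|) <= 1 by rewrite ler_pdivrMr //; lra.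
have := key _ l0 l1; rewrite mulrAC ler_pdivlMr //; nra.
Qed.

Variables (L : R) (g : 'rV[R]_d -> R).
Hypothesis L_gt0 : 0 < L.
Hypothesis gA1 : A1_comp L g.

Lemma convex_gradient x y : g x + dotv (grad g x) (y - x) <= g y.
Proof.
have sc : strongly_convex 0 g.
  by move=> a b l l01; rewrite !mul0r subr0; exact: gA1.1.
have := gradient_inequality _ _ _ y _ _ (smooth_bound _ _ gA1 x) sc.
by rewrite !mul0r addr0.
Qed.

(** At the gradient-step point [x - L^-1 *: (grad g x - grad g y)], convexity based at [y] bounds
    [g] from below and smoothness based at [x] bounds it from above; comparing the two gives the
    claim. *)
Lemma cocoercive x y :
  dotv (grad g x - grad g y) (grad g x - grad g y) <=
  2 * L * (g x - g y - dotv (grad g y) (x - y)).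
Proof.
have lower z := convex_gradient y z; have upper z := smooth_bound _ _ gA1 x z.
move: lower upper; move: (grad g x) (grad g y) => gx gy lower upper.
have := lower (x - L^-1 *: (gx - gy)).
have /ler_normlP [_] := upper (x - L^-1 *: (gx - gy)).
have subKl (a w : 'rV[R]_d) : a - w - a = - w by rewrite addrAC subrr add0r.
rewrite subKl [x - _ - y]addrAC.
rewrite !dotvE (dotvC gy gx); move: (g x) (g y) (g _) => fx fy fz.
move: (dotv gx gx) (dotv gx gy) (dotv gy gy) (dotv gy x) (dotv gy y) => A B C s t.
move=> h1 h2; have LK : L * L^-1 = 1 by rewrite mulfV // gt_eqF.
move: (L^-1) LK h1 h2 => K LK h1 h2.
have LKm z : L * K * z = z by rewrite LK mul1r.
have e : L / 2 * - - (K * (K * (A - B) - K * (B - C))) = K / 2 * (A - B - (B - C)).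
  by rewrite -[RHS](LKm); ring.
rewrite e in h1; set r := fx - fy - (s - t).
have h3 : K / 2 * (A - B - (B - C)) <= r by rewrite /r; lra.
have -> : A - B + (- B - - C) = 2 * L * (K / 2 * (A - B - (B - C))).
  by rewrite -[LHS]LKm; field.
by rewrite ler_pM2l // mulr_gt0.
Qed.

(** In each coordinate the quadratic errors at the two points add up to at most [L * nu ^+ 2].
    Dividing by [2 * nu] leaves [L * nu / 2], and the [d] squared coordinates are summed. *)
Lemma central_difference_error (nu : R) x b : 0 < nu ->
  b = \row_j ((g (x + nu *: ej R j) - g (x - nu *: ej R j)) / (2 * nu)) - grad g x ->
  dotv b b <= L ^+ 2 * nu ^+ 2 * d%:R / 4.
Proof.
move=> nu0 bE.
have bj j : b 0 j ^+ 2 <= L ^+ 2 * nu ^+ 2 / 4.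
  have e1 : dotv (ej R j) (ej R j) = 1 by rewrite dotv_ej mxE !eqxx.
  have := smooth_bound _ _ gA1 x (x + nu *: ej R j).
  have := smooth_bound _ _ gA1 x (x - nu *: ej R j).
  rewrite ![x + _]addrC !addrK !dotvE !e1 dotv_ej.
  have -> : b 0 j = ((g (nu *: ej R j + x) - g (- (nu *: ej R j) + x)) / (2 * nu)) -
     grad g x 0 j by rewrite bE !mxE ![_ + x]addrC.
  (* [p] is the value at the backward point and [m] the value at the forward point. *)
  set p := g _; set m := g (_ + x); set D := grad g x 0 j; set f0 := g x.
  move=> /ler_normlP [h1 h2] /ler_normlP [h3 h4].
  have -> : L ^+ 2 * nu ^+ 2 / 4 = (L * nu / 2) ^+ 2 by field.
  have -> : (m - p) / (2 * nu) - D = (m - p - 2 * nu * D) / (2 * nu) by field; lra.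
  set y := (m - p - _) / _.
  have ey : y * (2 * nu) = m - p - 2 * nu * D by rewrite /y divfK //; lra.
  have y1 : y <= L * nu / 2 by rewrite -(ler_pM2r (_ : 0 < 2 * nu)) ?mulr_gt0 // ey; nra.
  have y2 : - y <= L * nu / 2 by rewrite -(ler_pM2r (_ : 0 < 2 * nu)) ?mulr_gt0 // mulNr ey; nra.
  nra.
have -> : L ^+ 2 * nu ^+ 2 * d%:R / 4 = \sum_(j < d) (L ^+ 2 * nu ^+ 2 / 4).
  by rewrite sumr_const card_ord -[RHS]mulr_natl; field.
by apply: ler_sum => j _; rewrite -expr2.
Qed.

End Gradients.

(** * The proximal step for a fixed gradient estimate *)

Section ProxStep.
Context {R : realType} {d : nat}.

(* x is the Jensen average of the prox center and X; completing the square
   in G leaves only the deviation of G from v, since a * g = 1 / (12 L). *)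
Lemma prox_step (F : 'rV[R]_d -> R) (v X x G z : 'rV[R]_d) (L tau a g : R) :
  0 < L -> 0 <= tau -> 0 < a -> 0 < g -> 12 * L * a * g = 1 ->
  (forall y, F y <= F X + dotv v (y - X) + L / 2 * dotv (y - X) (y - X)) ->
  forall xp x', xp = (1 + g * tau)^-1 *: (x + g * tau *: X) ->
  x' = (1 + g * tau)^-1 *: (x + g * tau *: X - g *: G) ->
  F (X + a *: (x' - xp)) + 6 * L * a ^+ 2 * (1 + tau * g) * dotv (x' - z) (x' - z)
  <= F X + 6 * L * a ^+ 2 * dotv (x - z) (x - z) + a * tau / 2 * dotv (X - z) (X - z)
     + a * dotv G (z - xp) + dotv (G - v) (G - v) / (12 * L).
Proof.
move=> L0 tau0 a0 g0 lag sm xp x' xpE x'E.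
have m0 : 0 <= g * tau by rewrite mulr_ge0 // ltW.
have q0 : 0 < 1 + g * tau by lra.
(* [h] is the effective step size: [x' = xp - h *: G]. *)
pose h := g / (1 + g * tau).
have h0 : 0 < h by rewrite divr_gt0.
have hq : h * (1 + g * tau) = g by rewrite /h divfK //; lra.
have ex : x' - xp = - (h *: G).
  by apply/rowP => j; rewrite ?x'E ?xpE !mxE ?/h; field; lra.
have exz : x' - z = (xp - z) - h *: G by rewrite -ex; apply/rowP => j; rewrite !mxE; ring.
have jen : (1 + g * tau) * dotv (xp - z) (xp - z) <=
    dotv (x - z) (x - z) + g * tau * dotv (X - z) (X - z).
  have exp : (1 + g * tau) *: (xp - z) = (x - z) + g * tau *: (X - z).
    by apply/rowP => j; rewrite ?x'E ?xpE !mxE ?/h; field; lra.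
  rewrite -(ler_pM2l q0).
  have -> : (1 + g * tau) * ((1 + g * tau) * dotv (xp - z) (xp - z)) =
     dotv ((1 + g * tau) *: (xp - z)) ((1 + g * tau) *: (xp - z)).
    by rewrite dotvZl dotvZr.
  rewrite exp; move: (x - z) (X - z) => u w; move: (dotv_ge0 (u - w)).
  rewrite !dotvE (dotvC w u); move: (dotv u u) (dotv u w) (dotv w w) => s t r.
  move: (g * tau) m0 => m m0 h1; nra.
have {sm} := sm (X + a *: (x' - xp)).
rewrite [X + _]addrC addrK addrC ex exz -[z - xp]opprB.
move: jen; move: (xp - z) (dotv (x - z) _) (dotv (X - z) _) => w A B jen.
rewrite !dotvE (dotvC w G) (dotvC v G).
(* Nonnegativity of this square, divided by 4, is exactly the bound of [3 / 4 * GG - Gv] by the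
   squared deviation of [G] from [v]. *)
have := dotv_ge0 (G - 2 *: (G - v)).
have := dotv_ge0 (G - v).
rewrite !dotvE (dotvC v G).
move: (F _) (F X) jen (dotv_ge0 G) => Fy FX.
move: (dotv w w) (dotv G w) (dotv G G) (dotv G v) (dotv v v) => ww Gw GG Gv vv.
move=> jen GG0 D0 E0 le_Fy.
set D := GG - Gv + (- Gv - - vv); rewrite -/D in D0.
have {}E0 : 3 / 4 * GG - Gv <= D by rewrite /D; lra.
pose k := a * h; have k0 : 0 < k by rewrite mulr_gt0.
have Lk : 12 * L * k <= 1.
  rewrite -[leRHS]lag /k mulrA ler_pM2l ?mulr_gt0 //.
  by rewrite /h ler_pdivrMr // ler_peMr ?(ltW g0) //; lra.
have kD : k * D <= D / (12 * L).
  rewrite ler_pdivlMr ?mulr_gt0 // (_ : k * D * (12 * L) = 12 * L * k * D); last by ring.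
  by rewrite -[leRHS]mul1r ler_wpM2r.
(* This identity dictates the weight [6 * L * a ^+ 2] of the squared distance: since
   [h * (1 + g * tau) = g], the cross term of the expanded square becomes exactly [- a * Gw]. *)
have ga : 6 * L * a ^+ 2 * g = a / 2.
  by rewrite -[RHS]mul1r -[X in _ = X * _]lag; field.
have -> : 6 * L * a ^+ 2 * (1 + tau * g) * (ww - h * Gw + (- (h * Gw) - h * - (h * GG))) =
    6 * L * a ^+ 2 * ((1 + g * tau) * ww) - a * Gw + k / 2 * GG.
  have e : 6 * L * a ^+ 2 * (1 + tau * g) * h = a / 2 by rewrite -ga -[X in _ = _ * X]hq; ring.
  transitivity (6 * L * a ^+ 2 * ((1 + g * tau) * ww)
    - 2 * (6 * L * a ^+ 2 * (1 + tau * g) * h) * Gw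
    + (6 * L * a ^+ 2 * (1 + tau * g) * h) * h * GG); first by ring.
  by rewrite e /k; field.
have {}jen : 6 * L * a ^+ 2 * ((1 + g * tau) * ww) <= 6 * L * a ^+ 2 * A + a * tau / 2 * B.
  rewrite (_ : a * tau / 2 * B = 6 * L * a ^+ 2 * (g * tau * B)).
    by rewrite -mulrDr ler_wpM2l // ltW // !mulr_gt0 // exprn_gt0.
  by rewrite [a * tau / 2]mulrAC -ga; ring.
have {}le_Fy : Fy <= FX - k * Gv + L * k * (k / 2 * GG).
  by apply: le_trans le_Fy _; rewrite le_eqVlt; apply/orP; left; apply/eqP; rewrite /k; field.
have kG : 0 <= k / 2 * GG by apply: mulr_ge0 => //; lra.
have LkG : 12 * (L * k * (k / 2 * GG)) <= k / 2 * GG.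
  rewrite (_ : 12 * _ = 12 * L * k * (k / 2 * GG)); last by ring.
  by rewrite -[leRHS]mul1r ler_wpM2r.
have := ler_wpM2l (ltW k0) E0; lra.
Qed.
End ProxStep.

(** * The expected inner step *)

Section FiniteSum.
Context {R : realType} {d n : nat}.
Variables (f : nat -> 'rV[R]_d -> R) (L tau nu : R).
Hypotheses (n_gt0 : (0 < n)%N) (L_gt0 : 0 < L) (tau_ge0 : 0 <= tau) (nu_gt0 : 0 < nu).
Hypothesis fA1 : forall i, (i < n)%N -> A1_comp L (f i).
Hypothesis F_sc : strongly_convex tau (fbar n f).

Local Notation F := (fbar n f).

(** Stands in for the gradient of [fbar]: what is used is its quadratic expansion, inherited from
    the components. *)
Definition mean_grad (x : 'rV[R]_d) : 'rV[R]_d :=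
  n%:R^-1 *: \sum_(i < n) grad (f i) x.

Definition bregman (x y : 'rV[R]_d) : R := F y - F x - dotv (mean_grad x) (y - x).

Lemma bregmanE x y :
  bregman x y = avg n (fun i => f i y - f i x - dotv (grad (f i) x) (y - x)).
Proof.
rewrite /bregman /mean_grad (dotv_vavg n d (fun i => grad (f i) x)) /fbar /avg.
by rewrite -!mulrBr -!sumrB.
Qed.

Lemma bregman_smooth x y : `|bregman x y| <= L / 2 * dotv (y - x) (y - x).
Proof.
rewrite bregmanE ler_norml -[L / 2 * _](avg_cst _ n_gt0).
rewrite -mulN1r -(avgZ n (-1) (fun=> _)).
apply/andP; split; apply: ler_avg => i ilt; rewrite ?mulN1r.
  by have /ler_normlP [] := smooth_bound _ _ (fA1 _ ilt) x y; lra.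
by have /ler_normlP [] := smooth_bound _ _ (fA1 _ ilt) x y; lra.
Qed.

Lemma bregman_strong x y : tau / 2 * dotv (y - x) (y - x) <= bregman x y.
Proof.
have := gradient_inequality F _ _ y _ _ (bregman_smooth x) F_sc.
rewrite /bregman; lra.
Qed.

Lemma bregman_ge0 x y : 0 <= bregman x y.
Proof.
by apply: le_trans (bregman_strong x y); rewrite !mulr_ge0 ?dotv_ge0 // invr_ge0.
Qed.

Local Notation bias i x := (gnu_i f nu i x - grad (f i) x).

Let err2 : R := L ^+ 2 * nu ^+ 2 * d%:R / 4.

Lemma bias_le i x : (i < n)%N -> dotv (bias i x) (bias i x) <= err2.
Proof. by move=> ilt; exact: (central_difference_error _ _ (fA1 _ ilt) _ x _ nu_gt0 erefl). Qed.

Lemma mean_bias_le x :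
  dotv (gnu n f nu x - mean_grad x) (gnu n f nu x - mean_grad x) <= err2.
Proof.
have e : gnu n f nu x - mean_grad x = n%:R^-1 *: \sum_(i < n) bias i x.
  by rewrite /gnu /mean_grad -scalerBr sumrB.
apply: le_trans (vavg_sq_le _ n_gt0 _ _ _ e) _.
by rewrite -[leRHS](avg_cst _ n_gt0); apply: ler_avg => i; apply: bias_le.
Qed.

(** [G - mean_grad X] is a centred gradient difference plus three biases. Squaring costs a factor 2
    on the first and 6 on each squared bias, hence 18. Centring only lowers the second moment, which
    cocoercivity bounds by [2 * L * bregman X y]. *)
Lemma variance_reduction X y :
  avg n (fun i => let G := gnu_i f nu i X - gnu_i f nu i y + gnu n f nu y in
    dotv (G - mean_grad X) (G - mean_grad X)) <= 4 * L * bregman X y + 18 * err2.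
Proof.
pose z i := grad (f i) y - grad (f i) X; pose m := mean_grad y - mean_grad X.
have mE : m = n%:R^-1 *: \sum_(i < n) z i.
  by rewrite /m /mean_grad -scalerBr sumrB.
apply: (@le_trans _ _ (avg n (fun i => 2 * dotv (z i - m) (z i - m) + 18 * err2))).
  apply: ler_avg => i ilt /=.
  have b1 := bias_le _ X ilt; have b2 := bias_le _ y ilt; have b3 := mean_bias_le y.
  set G := _ + _ - _.
  have -> : G = - (z i - m) + (bias i X - bias i y + (gnu n f nu y - mean_grad y)).
    rewrite /G /z /m; move: (gnu_i _ _ _ X) (gnu_i _ _ _ y) (gnu _ _ _ y).
    move: (grad _ X) (grad _ y) (mean_grad X) (mean_grad y).
    by move=> P Q S T A B C; apply/rowP => j; rewrite !mxE; ring.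
  move: b1 b2 b3; move: (z i - m) (bias i X) (bias i y) (gnu n f nu y - _) => w p q r.
  have := dotv_ge0 (w + (p - q + r)); have := dotv_ge0 (p + q).
  have := dotv_ge0 (p - r); have := dotv_ge0 (q + r).
  rewrite !dotvE (dotvC q p) (dotvC r p) (dotvC r q) (dotvC p w) (dotvC q w) (dotvC r w).
  lra.
rewrite avgD avgZ avg_cst // lerD2r.
rewrite (_ : 4 * L * bregman X y = 2 * (2 * L * bregman X y)); last by ring.
rewrite ler_pM2l //; apply: le_trans (variance_le _ n_gt0 _ _ _ mE) _.
rewrite bregmanE -avgZ; apply: ler_avg => i ilt.
exact: cocoercive (fA1 _ ilt) _ _.
Qed.

Lemma bias_dot_le X u : dotv (gnu n f nu X - mean_grad X) u <=
  L * nu * Num.sqrt d%:R / 2 * enorm u.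
Proof.
apply: dotv_le_norm; first by rewrite !mulr_ge0 ?invr_ge0 ?sqrtr_ge0 // ltW.
apply: le_trans (mean_bias_le X) _; rewrite /err2 !exprMn sqr_sqrtr ?ler0n //.
by rewrite le_eqVlt; apply/orP; left; apply/eqP; field.
Qed.

(** The middle point [X] is designed for two identities: the new averaged point is
    [X + a *: (x' - xp)], and [a *: (z - xp)] splits into displacements from [X] towards [z], [xb]
    and [xt]. The linear term of the proximal step thus becomes gaps minus Bregman divergences. *)
Lemma expected_step (a g : R) (z x xb xt : 'rV[R]_d) :
  0 < a -> a <= 1 / 2 -> 0 < g -> 12 * L * a * g = 1 ->
  forall X st, X = xlow tau g a (1 / 2) xt (x, xb) ->
  st = istep f nu tau g a (1 / 2) xt (gnu n f nu xt) (x, xb) ->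
  avg n (fun i => F (st i).2 - F z
     + 6 * L * a ^+ 2 * (1 + tau * g) * enorm ((st i).1 - z) ^+ 2)
  <= (1 / 2 - a) * (F xb - F z) + 1 / 2 * (F xt - F z)
     + 6 * L * a ^+ 2 * enorm (x - z) ^+ 2 + 3 / 8 * (nu ^+ 2 * L * d%:R)
     + L * nu * Num.sqrt d%:R / 2 * ((1 / 2 - a) * enorm (xb - z)
        + 1 / 2 * enorm (xt - z) + enorm (X - z)).
Proof.
move=> a0 a_half g0 lag X st XE stE.
pose xp := (1 + g * tau)^-1 *: (x + g * tau *: X).
pose G i := gnu_i f nu i X - gnu_i f nu i xt + gnu n f nu xt.
have tg0 : 0 <= tau * g by rewrite mulr_ge0 // ltW.
have q0 : 1 + g * tau != 0 by rewrite gt_eqF // [g * _]mulrC; lra.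
have q1 : 1 + tau * g * (1 - a) != 0.
  by rewrite gt_eqF // ltr_wpDr // mulr_ge0 //; lra.
have split_xp : a *: (z - xp) =
    a *: (z - X) + (1 / 2 - a) *: (xb - X) + (1 / 2) *: (xt - X).
  apply/rowP => j; rewrite /xp XE /xlow !mxE /=.
  by field; rewrite q0 q1.
have st2 i : (st i).2 = X + a *: ((st i).1 - xp).
  rewrite stE /istep -XE /=; move: (_ *: (x + _ - _)) => w.
  apply/rowP => j; rewrite /xp XE /xlow !mxE /=.
  by field; rewrite q0 q1.
have step i : F (st i).2 - F z + 6 * L * a ^+ 2 * (1 + tau * g) * enorm ((st i).1 - z) ^+ 2
   <= (F X - F z + 6 * L * a ^+ 2 * enorm (x - z) ^+ 2 + a * tau / 2 * dotv (X - z) (X - z))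
      + (dotv (G i) (a *: (z - xp)) +
      (12 * L)^-1 * dotv (G i - mean_grad X) (G i - mean_grad X)).
  have sm y : F y <= F X + dotv (mean_grad X) (y - X) + L / 2 * dotv (y - X) (y - X).
    by have /ler_normlP [_] := bregman_smooth X y; rewrite /bregman; lra.
  have x'E : (st i).1 = (1 + g * tau)^-1 *: (x + g * tau *: X - g *: G i).
    by rewrite stE /istep -XE.
  have := prox_step F _ _ x (G i) z _ _ _ _ L_gt0 tau_ge0 a0 g0 lag sm xp (st i).1 erefl x'E.
  rewrite -st2 !enorm_sq [dotv (G i) (a *: _)]dotvZr.
  rewrite [(12 * L)^-1 * _]mulrC.
  move: (dotv (G i - _) _ / _) => w; lra.
apply: le_trans (ler_avg _ _ _ (fun i _ => step i)) _.
rewrite avgD avg_cst // avgD avgZ.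
have var : (12 * L)^-1 * avg n (fun i => dotv (G i - mean_grad X) (G i - mean_grad X))
    <= 1 / 3 * bregman X xt + 3 / 8 * (nu ^+ 2 * L * d%:R).
  have -> : 1 / 3 * bregman X xt + 3 / 8 * (nu ^+ 2 * L * d%:R) =
      (12 * L)^-1 * (4 * L * bregman X xt + 18 * err2).
    by rewrite /err2; field; rewrite gt_eqF.
  by rewrite ler_pM2l ?invr_gt0 ?mulr_gt0 //; exact: variance_reduction.
(* The control variate averages out, so the mean of [G] is [gnu n f nu X]; only the
   finite-difference bias separates it from [mean_grad X]. *)
have -> : avg n (fun i => dotv (G i) (a *: (z - xp))) =
    dotv (gnu n f nu X - mean_grad X) (a *: (z - xp)) + dotv (mean_grad X) (a *: (z - xp)).
  rewrite -dotvDl subrK -(dotv_vavg n d G); congr dotv.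
  rewrite /G big_split sumrB /= sumr_const card_ord scalerDr scalerBr.
  rewrite -(scaler_nat n (gnu n f nu xt)) scalerA mulVf ?pnatr_eq0 -?lt0n //.
  by rewrite scale1r -/(gnu n f nu xt) subrK.
have bias_u : dotv (gnu n f nu X - mean_grad X) (a *: (z - xp)) <=
    L * nu * Num.sqrt d%:R / 2 * ((1 / 2 - a) * enorm (xb - z)
        + 1 / 2 * enorm (xt - z) + enorm (X - z)).
  (* Recentring at [z] leaves only distances to the minimizer, which are the ones later bounded by
     [Z]. *)
  have -> : a *: (z - xp) = (1 / 2 - a) *: (xb - z) + (1 / 2) *: (xt - z) + (z - X).
    by rewrite split_xp; apply/rowP => j; rewrite !mxE; field.
  rewrite dotvDr (dotvDr (_ *: _)) !(dotvZr _ (_ - z)) (enormB X) !mulrDr.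
  apply: lerD; last exact: bias_dot_le.
  apply: lerD; rewrite mulrCA; apply: ler_wpM2l; try exact: bias_dot_le.
    by rewrite subr_ge0.
  by rewrite divr_ge0.
have grad_u : dotv (mean_grad X) (a *: (z - xp)) = a * (F z - F X - bregman X z)
   + (1 / 2 - a) * (F xb - F X - bregman X xb) + 1 / 2 * (F xt - F X - bregman X xt).
  by rewrite split_xp !dotvDr !dotvZr /bregman; ring.
(* The divergence to [z] pays for the [a * tau / 2] term, the one to [xb] is dropped, and the one to
   [xt], of weight 1/2, absorbs the 1/3 coming from the variance. *)
have bz := bregman_strong X z; have bxb := bregman_ge0 X xb; have bxt := bregman_ge0 X xt.
have sym : dotv (z - X) (z - X) = dotv (X - z) (X - z).
  by rewrite -(opprB X z) dotvNl dotvNr opprK.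
have {}bz : a * (tau / 2 * dotv (X - z) (X - z)) <= a * bregman X z.
  by rewrite ler_pM2l // -sym.
have {}bxb : 0 <= (1 / 2 - a) * bregman X xb by rewrite mulr_ge0 //; lra.
move: var bias_u grad_u bz bxb bxt.
move: (dotv (X - z) (X - z)) => Q; move: (dotv _ (a *: _)) => D1.
move: (dotv _ (a *: _)) (avg _ _) => D2 V.
lra.
Qed.

End FiniteSum.

(** * Expectation over the index draws *)

Section Expectation.
Context {R : realType} (n : nat).
Hypothesis n_gt0 : (0 < n)%N.
Implicit Types (F G : (nat -> nat) -> R) (w : nat -> nat).

Let n_neq0 : n%:R != 0 :> R. Proof. by rewrite pnatr_eq0 -lt0n. Qed.

Lemma ExpD K F G : Exp n K (fun w => F w + G w) = Exp n K F + Exp n K G.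
Proof. by rewrite /Exp big_split mulrDr. Qed.

Lemma ExpZ K c F : Exp n K (fun w => c * F w) = c * Exp n K F.
Proof. by rewrite /Exp -big_distrr /= mulrCA. Qed.

Lemma Exp_cst K (c : R) : Exp n K (fun=> c) = c.
Proof.
rewrite /Exp sumr_const card_tuple card_ord -[X in _ * X]mulr_natl natrX mulKf //.
by rewrite expf_neq0.
Qed.

Lemma ler_Exp K F G : (forall w, F w <= G w) -> Exp n K F <= Exp n K G.
Proof.
by move=> FG; rewrite ler_wpM2l ?invr_ge0 ?exprn_ge0 ?ler0n // ler_sum.
Qed.

Definition update w (K i : nat) : nat -> nat := fun k => if k == K then i else w k.

(** Conditioning on the first [K] draws: appending an index identifies pairs of a [K]-tuple and an
    index with [K.+1]-tuples. *)
Lemma ExpS K F : Exp n K.+1 F = Exp n K (fun w => avg n (fun i => F (update w K i))).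
Proof.
rewrite /Exp /avg exprS invfM -mulrA mulrCA -big_distrr /=; congr (_ * (_ * _)).
pose h (p : K.-tuple 'I_n * 'I_n) := [tuple of rcons p.1 p.2].
have h_bij : bijective h.
  apply: inj_card_bij => [[t i] [u j] /(congr1 val) /= /rcons_inj [tu ->]|].
    by congr pair; apply: val_inj.
  by rewrite card_prod !card_tuple card_ord expnSr.
rewrite (reindex h) /=; last exact: onW_bij.
rewrite pair_bigA /=; apply: eq_bigr => -[t i] _ /=; congr F; apply/funext => k.
rewrite /update map_rcons nth_rcons size_map size_tuple.
(* Beyond position [K] both streams take the default value 0. *)
case: ltngtP => // Kk; rewrite nth_default // size_map size_tuple; exact: ltnW.
Qed.

(** Measurability with respect to the first [K] draws. *)
Definition depends_below K F := forall w w',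
  (forall k, (k < K)%N -> w k = w' k) -> F w = F w'.

Lemma Exp_widen K K' F : depends_below K F -> (K <= K')%N -> Exp n K' F = Exp n K F.
Proof.
move=> dF; elim: K' => [|K' IH]; first by rewrite leqn0 => /eqP ->.
rewrite leq_eqVlt => /orP[/eqP ->//|KK']; rewrite ExpS -(IH KK').
congr Exp; apply/funext => w; rewrite -[RHS](avg_cst n n_gt0); congr (_ * _).
apply: eq_bigr => i _; apply: dF => k kK; rewrite /update ltn_eqF //.
exact: leq_trans kK KK'.
Qed.

(** Averages over draw [k] inside the common sample space of a whole epoch, where later draws are
    present as well; both sides reduce to an expectation over the first [k] draws. *)
Lemma Exp_resample K k F : (k < K)%N -> depends_below k.+1 F ->
  Exp n K F = Exp n K (fun w => avg n (fun i => F (update w k i))).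
Proof.
move=> kK dF; rewrite (Exp_widen k.+1) // ExpS [RHS](Exp_widen k) ?(ltnW kK) //.
move=> w w' ww'; congr (_ * _); apply: eq_bigr => i _; apply: dF => j.
by rewrite ltnS /update; case: ltngtP => // jk _; exact: ww'.
Qed.

End Expectation.

(** * The iterates depend only on past draws *)

Section Adapted.
Context {R : realType} {d n : nat}.
Variables (f : nat -> 'rV[R]_d -> R) (nu tau : R).
Variables (T : nat -> nat) (gam alp ps : nat -> R) (th : nat -> nat -> R).
Variable x0 : 'rV[R]_d.

Local Notation outer := (outer n f nu tau T gam alp ps th x0).
Local Notation epoch := (run_epoch n f nu tau T gam alp ps).

Lemma drawsS s : draws T s.+1 = (draws T s + T s.+1)%N.
Proof. by rewrite /draws big_nat_recr. Qed.

Lemma run_epochS s prev w t :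
  epoch s prev w t.+1 = istep f nu tau (gam s) (alp s) (ps s) prev.2
    (gnu n f nu prev.2) (epoch s prev w t) (w (draws T s.-1 + t)).
Proof. by []. Qed.

Lemma run_epoch_adapted s prev w w' t :
  (forall k, (k < draws T s.-1 + t)%N -> w k = w' k) ->
  epoch s prev w t = epoch s prev w' t.
Proof.
elim: t => [//|t IH] ww'; rewrite !run_epochS IH => [|k kt]; last first.
  by apply: ww'; rewrite addnS ltnS ltnW.
by rewrite ww' // addnS.
Qed.

Lemma outer_adapted s w w' :
  (forall k, (k < draws T s)%N -> w k = w' k) -> outer w s = outer w' s.
Proof.
elim: s => [//|s IH] ww' /=.
have -> : outer w s = outer w' s.
  by apply: IH => k ks; apply: ww'; rewrite drawsS ltn_addr.
have e t : (t <= T s.+1)%N ->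
    epoch s.+1 (outer w' s) w t = epoch s.+1 (outer w' s) w' t.
  move=> tT; apply: run_epoch_adapted => k ks; apply: ww'.
  by rewrite drawsS; apply: leq_trans ks _; rewrite leq_add2l.
rewrite e //; congr (_, _ *: _).
by apply: eq_big_nat => t /andP[_]; rewrite ltnS => tT; rewrite e.
Qed.

End Adapted.

(** * One epoch *)

Section WeightedSums.
Context {R : realType}.
Implicit Types (A D th : nat -> R) (r c q e : R).

(** Step [t] is multiplied by [q ^+ t]; the distance it produces, [c * q ^+ t.+1 * D t.+1], is the
    one that step [t.+1] consumes. *)
Lemma telescoped_descent A D r c q e m : 0 <= q ->
  (forall t, (t < m)%N ->
     A t.+1 + c * q * D t.+1 <= r * A t + 1 / 2 * A 0%N + c * D t + e) ->
  \sum_(t < m) q ^+ t * A t.+1 + c * q ^+ m * D m <=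
  r * (\sum_(t < m) q ^+ t * A t) + (\sum_(t < m) q ^+ t) * (1 / 2 * A 0%N + e) + c * D 0%N.
Proof.
move=> q0; elim: m => [|m IH] step; first by rewrite !big_ord0 expr0; lra.
have {IH} := IH (fun t tm => step t (ltnW tm)).
have := ler_wpM2l (exprn_ge0 m q0) (step m (ltnSn m)).
rewrite !big_ord_recr /= exprS; move: (\sum_(_ < _) _) (\sum_(_ < _) _) (\sum_(_ < _) _).
by move=> s1 s2 s3; move: (q ^+ m) (A m) (A m.+1) (D m) (D m.+1) => *; lra.
Qed.

(** The prescribed weights are what remains after moving the [r * A t] terms of the telescoped
    descent to the left; the shift of index leaves the boundary term [r * A 0]. *)
Lemma theta_sum A th r q m :
  (forall t, (t < m)%N -> th t.+1 = q ^+ t - r * q ^+ t.+1) -> th m.+1 = q ^+ m ->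
  \sum_(t < m.+1) th t.+1 * A t.+1 =
  \sum_(t < m.+1) q ^+ t * A t.+1 - r * (\sum_(t < m.+1) q ^+ t * A t) + r * A 0%N.
Proof.
move=> th_lt th_m; rewrite [LHS]big_ord_recr /= th_m [X in X - _]big_ord_recr /=.
rewrite [X in r * X]big_ord_recl /= expr0 mul1r.
under [X in X + _ = _]eq_bigr => t _ do rewrite th_lt // mulrBl -mulrA.
by rewrite sumrB -mulr_sumr /bump /=; ring.
Qed.

End WeightedSums.

(** * Descent in expectation over an epoch *)

Section Epoch.
Context {R : realType} {d n : nat}.
Variables (f : nat -> 'rV[R]_d -> R) (L tau nu Z : R).
Hypotheses (n_gt0 : (0 < n)%N) (L_gt0 : 0 < L) (tau_ge0 : 0 <= tau) (nu_gt0 : 0 < nu).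
Hypothesis fA1 : forall i, (i < n)%N -> A1_comp L (f i).
Hypothesis F_sc : strongly_convex tau (fbar n f).
Variables (T : nat -> nat) (gam alp : nat -> R) (th : nat -> nat -> R).
Variables x0 z : 'rV[R]_d.

Local Notation F := (fbar n f).
Local Notation outer := (outer n f nu tau T gam alp (psch R) th x0).
Local Notation epoch := (run_epoch n f nu tau T gam alp (psch R)).

Definition gap (s : nat) : R := Exp n (draws T s) (fun w => F (outer w s).2 - F z).
Definition sqdist (s : nat) : R :=
  Exp n (draws T s) (fun w => enorm ((outer w s).1 - z) ^+ 2).

Lemma sqdist_ge0 s : 0 <= sqdist s.
Proof.
rewrite -(Exp_cst n n_gt0 (draws T s) 0).
by apply: ler_Exp => // w; exact: sqr_ge0.
Qed.

(** The weighted divergences from the barycentre [p] are nonnegative, and their linear parts cancel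
    because [S *: p] is the weighted sum of the points. *)
Lemma fbar_jensen m (th' : nat -> R) (y : nat -> 'rV[R]_d) :
  (forall t, (t < m)%N -> 0 <= th' t) -> 0 < \sum_(t < m) th' t ->
  F ((\sum_(t < m) th' t)^-1 *: \sum_(t < m) th' t *: y t) - F z <=
  (\sum_(t < m) th' t)^-1 * \sum_(t < m) th' t * (F (y t) - F z).
Proof.
set S := \sum_(t < m) th' t => th0 S0; set p := _ *: _.
rewrite mulrC ler_pdivlMr // -subr_ge0.
have Sp : S *: p = \sum_(t < m) th' t *: y t.
  by rewrite /p scalerA mulfV ?scale1r // gt_eqF.
have -> : \sum_(t < m) th' t * (F (y t) - F z) - (F p - F z) * S =
    \sum_(t < m) th' t * @bregman R d n f p (y t) +
    dotv (@mean_grad R d n f p) (S *: p - S *: p).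
  rewrite {1}Sp dotvDr dotvNr dotvZr /S.
  rewrite dotvC dotv_suml !mulr_suml mulr_sumr -!sumrB -big_split /=.
  by apply: eq_bigr => t _; rewrite /bregman dotvDr dotvNr dotvZl (dotvC (y t)); ring.
rewrite subrr dotv0r addr0.
by apply: sumr_ge0 => t _; rewrite mulr_ge0 ?th0 //; exact: (bregman_ge0 f L tau).
Qed.

Section OneEpoch.
Variable s : nat.
Hypotheses (alp_gt0 : 0 < alp s.+1) (alp_half : alp s.+1 <= 1 / 2) (gam_gt0 : 0 < gam s.+1).
Hypothesis alp_gam : 12 * L * alp s.+1 * gam s.+1 = 1.
Hypothesis xbar_Z : forall t, (t <= T s.+1)%N -> Exp n (draws T s.+1)
  (fun w => enorm (xbar_it n f nu tau T gam alp (psch R) th x0 w s.+1 t - z)) <= Z.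
Hypothesis xlow_Z : forall t, (1 <= t <= T s.+1)%N -> Exp n (draws T s.+1)
  (fun w => enorm (xlow_it n f nu tau T gam alp (psch R) th x0 w s.+1 t - z)) <= Z.

Local Notation K := (draws T s.+1).
Local Notation st w t := (epoch s.+1 (outer w s) w t).

Lemma Z_ge0 : 0 <= Z.
Proof.
apply: le_trans (xbar_Z 0 (leq0n _)); rewrite -[leLHS](Exp_cst n n_gt0 K).
by apply: ler_Exp => // w; exact: enorm_ge0.
Qed.

Let A t := Exp n K (fun w => F (st w t).2 - F z).
Let D t := Exp n K (fun w => enorm ((st w t).1 - z) ^+ 2).
Let c := 6 * L * alp s.+1 ^+ 2.
(** Twice the error that one step produces, so that [2 * e] and [4 * e] carry the constants of the
    final bounds. *)
Let e := 3 / 4 * (nu ^+ 2 * L * d%:R) + 2 * (L * Num.sqrt d%:R * Z * nu).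

Lemma epoch_step t : (t < T s.+1)%N ->
  A t.+1 + c * (1 + tau * gam s.+1) * D t.+1 <=
  (1 / 2 - alp s.+1) * A t + 1 / 2 * A 0%N + c * D t + e.
Proof.
move=> tT; set k := (draws T s + t)%N.
have kK : (k < K)%N by rewrite /k drawsS ltn_add2l.
pose H w := F (st w t.+1).2 - F z +
  c * (1 + tau * gam s.+1) * enorm ((st w t.+1).1 - z) ^+ 2.
have -> : A t.+1 + c * (1 + tau * gam s.+1) * D t.+1 = Exp n K H.
  by rewrite /A /D -ExpZ -ExpD.
have st_dep m w w' : (forall j, (j < draws T s + m)%N -> w j = w' j) -> st w m = st w' m.
  move=> ww'; have -> : outer w s = outer w' s.
    by apply: outer_adapted => j js; apply: ww'; rewrite ltn_addr.
  exact: run_epoch_adapted.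
have H_dep : depends_below k.+1 H.
  by move=> w w' ww'; rewrite /H (st_dep t.+1 w w') // => j; rewrite addnS; exact: ww'.
rewrite (Exp_resample n n_gt0 K k H kK H_dep).
pose X w := xlow_it n f nu tau T gam alp (psch R) th x0 w s.+1 t.+1.
pose B w := (1 / 2 - alp s.+1) * (F (st w t).2 - F z) + 1 / 2 * (F (st w 0).2 - F z)
     + c * enorm ((st w t).1 - z) ^+ 2 + 3 / 8 * (nu ^+ 2 * L * d%:R)
     + L * nu * Num.sqrt d%:R / 2 * ((1 / 2 - alp s.+1) * enorm ((st w t).2 - z)
        + 1 / 2 * enorm ((st w 0).2 - z) + enorm (X w - z)).
(* Resampling draw [k] changes neither the epoch's starting point nor the state at step [t], so the
   one-step estimate applies for every stream. *)
have HB w : avg n (fun i => H (update w k i)) <= B w.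
  have upd_out i : outer (update w k i) s = outer w s.
    by apply: outer_adapted => j js; rewrite /update ltn_eqF // ltn_addr.
  have upd_st i : st (update w k i) t = st w t.
    by apply: st_dep => j jk; rewrite /update ltn_eqF.
  pose G i := istep f nu tau (gam s.+1) (alp s.+1) (1 / 2) (outer w s).2
    (gnu n f nu (outer w s).2) (st w t) i.
  have upd i : epoch s.+1 (outer (update w k i) s) (update w k i) t.+1 = G i.
    by rewrite run_epochS upd_st upd_out /update eqxx.
  have -> : (fun i => H (update w k i)) = (fun i => F (G i).2 - F z +
      c * (1 + tau * gam s.+1) * enorm ((G i).1 - z) ^+ 2).
    by apply/funext => i; rewrite /H upd.
  rewrite /B /X /xlow_it /G /=; move: (st w t) => [x xb].
  exact: (expected_step f L tau nu n_gt0 L_gt0 tau_ge0 nu_gt0 fA1 F_sc _ _ z x xb _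
    alp_gt0 alp_half gam_gt0 alp_gam _ _ erefl erefl).
apply: le_trans (ler_Exp n K _ _ HB) _.
have lin (u v p y1 y2 y3 : (nat -> nat) -> R) (k1 k2 k3 k4 k5 k6 k7 : R) :
    Exp n K (fun w => k1 * u w + k2 * v w + k3 * p w + k4 +
      k5 * (k6 * y1 w + k7 * y2 w + y3 w)) =
    k1 * Exp n K u + k2 * Exp n K v + k3 * Exp n K p + k4 +
      k5 * (k6 * Exp n K y1 + k7 * Exp n K y2 + Exp n K y3).
  by rewrite !ExpD !ExpZ !ExpD !ExpZ Exp_cst.
rewrite (lin (fun w => F (st w t).2 - F z) (fun w => F (st w 0).2 - F z)
  (fun w => enorm ((st w t).1 - z) ^+ 2) (fun w => enorm ((st w t).2 - z))
  (fun w => enorm ((st w 0).2 - z)) (fun w => enorm (X w - z))).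
rewrite -/(A t) -/(A 0%N) -/(D t).
have xb_t := xbar_Z t (ltnW tT); have xb_0 := xbar_Z 0 (leq0n _).
have xl_t := xlow_Z t.+1 tT.
set Y := (X in L * nu * _ / 2 * X).
have le_Z : Y <= 2 * Z.
  have h1 : 0 <= 1 / 2 - alp s.+1 by rewrite subr_ge0.
  have Z0 := Z_ge0.
  have {}xb_t := ler_wpM2l h1 xb_t; have {}xb_0 := ler_wpM2l (_ : 0 <= 1 / 2) xb_0.
  have aZ : 0 <= alp s.+1 * Z by rewrite mulr_ge0 // ltW.
  apply: (@le_trans _ _ ((1 / 2 - alp s.+1) * Z + 1 / 2 * Z + Z)); last lra.
  by apply: lerD => //; apply: lerD => //; apply: xb_0; rewrite mulr_ge0 ?invr_ge0.
have nud : 0 <= L * nu * Num.sqrt d%:R / 2.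
  by rewrite !mulr_ge0 ?invr_ge0 ?sqrtr_ge0 // ltW.
move: le_Z => /(ler_wpM2l nud) le_Z.
clearbody Y.
have vs1 : 0 <= nu ^+ 2 * L * d%:R by rewrite !mulr_ge0 ?ler0n ?sqr_ge0 // ltW.
have vs2 : 0 <= L * nu * Num.sqrt d%:R / 2 * Z by rewrite mulr_ge0 // Z_ge0.
rewrite /e; move: (A t) (A 0%N) (D t) (nu ^+ 2 * L * d%:R) vs1 => At A0 Dt v vs1.
by move: (Num.sqrt d%:R : R) vs2 le_Z => r vs2 le_Z; lra.
Qed.

(** Stated for any growth factor [q] up to [1 + tau * gam s.+1] and for weights up to a scale [k],
    so that it serves early epochs with [q = 1] and late ones with the full factor. *)
Lemma epoch_descent (q k : R) (th' : nat -> R) (m : nat) : 0 < q -> q <= 1 + tau * gam s.+1 ->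
  0 < k -> T s.+1 = m.+1 ->
  (forall t, th s.+1 t = k * th' t) ->
  (forall t, (t < m)%N -> th' t.+1 = q ^+ t - (1 / 2 - alp s.+1) * q ^+ t.+1) ->
  (forall t, (t < m)%N -> 0 <= th' t.+1) -> th' m.+1 = q ^+ m ->
  let S := \sum_(t < m.+1) q ^+ t in
  let r := 1 / 2 - alp s.+1 in
  ((1 / 2 + alp s.+1) * S + r) * gap s.+1 + c * q ^+ m.+1 * sqdist s.+1 <=
  (1 / 2 * S + r) * gap s + S * e + c * sqdist s.
Proof.
move=> q0 q_le k0 Tm thE th_lt th_ge0 th_m; cbv zeta.
set S := \sum_(t < _) _; set r := 1 / 2 - _.
have c0 : 0 < c by rewrite !mulr_gt0 ?exprn_gt0.
(* [A] and [D] live on the draws of the whole epoch, [gap s] and [sqdist s] on the draws before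
   it. *)
have gapA : A 0%N = gap s.
  rewrite /A /gap; apply: (Exp_widen n n_gt0); last by rewrite drawsS leq_addr.
  by move=> w w' /(outer_adapted f nu tau T gam alp (psch R) th x0) /= ->.
have sqdistD : D 0%N = sqdist s.
  rewrite /D /sqdist; apply: (Exp_widen n n_gt0); last by rewrite drawsS leq_addr.
  by move=> w w' /(outer_adapted f nu tau T gam alp (psch R) th x0) /= ->.
have step t : (t < m.+1)%N ->
    A t.+1 + c * q * D t.+1 <= r * A t + 1 / 2 * A 0%N + c * D t + e.
  rewrite -Tm => /epoch_step; apply: le_trans; rewrite lerD2l.
  apply: ler_wpM2r; last by rewrite ler_wpM2l // ltW.
  rewrite -(Exp_cst n n_gt0 K 0); apply: ler_Exp => // w; exact: sqr_ge0.
have := telescoped_descent _ _ _ _ _ _ _ (ltW q0) step.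
have := theta_sum A _ _ _ _ th_lt th_m.
(* The same identity for the constant sequence evaluates the total weight. *)
have := theta_sum (fun=> 1) _ _ _ _ th_lt th_m.
rewrite -/r -/S gapA sqdistD !mulr1.
under eq_bigr => t _ do rewrite mulr1.
under [X in _ = X - _ + _]eq_bigr => t _ do rewrite mulr1.
under [X in _ = _ - r * X + _]eq_bigr => t _ do rewrite mulr1.
rewrite -/S => thS.
have S_ge1 : 1 <= S.
  by rewrite /S big_ord_recl expr0 lerDl sumr_ge0 // => t _; rewrite exprn_ge0 // ltW.
have a_gt0 := alp_gt0; have a_half := alp_half.
pose Th : R := \sum_(t < m.+1) th' t.+1.
have ThE : Th = (1 / 2 + alp s.+1) * S + r by rewrite /Th thS /r; field.
have Th_gt0 : 0 < Th by rewrite ThE /r; nra.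
have outerE w : (outer w s.+1).2 = Th^-1 *: \sum_(t < m.+1) th' t.+1 *: (st w t.+1).2.
  have e1 : \sum_(1 <= t < m.+2) th s.+1 t = k * Th.
    by rewrite big_add1 big_mkord mulr_sumr; apply: eq_bigr => t _; rewrite thE.
  have e2 : \sum_(1 <= t < m.+2) th s.+1 t *: (st w t).2 =
      k *: \sum_(t < m.+1) th' t.+1 *: (st w t.+1).2.
    by rewrite big_add1 big_mkord scaler_sumr; apply: eq_bigr => t _; rewrite thE scalerA.
  rewrite /= Tm e1 e2 scalerA invfM mulrAC mulVf ?mul1r //; exact: lt0r_neq0.
have outer1 w : (outer w s.+1).1 = (st w m.+1).1 by rewrite /= Tm.
have jensen : Th * gap s.+1 <= \sum_(t < m.+1) th' t.+1 * A t.+1.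
  have -> : \sum_(t < m.+1) th' t.+1 * A t.+1 =
     Exp n K (fun w => \sum_(t < m.+1) th' t.+1 * (F (st w t.+1).2 - F z)).
    rewrite /A /Exp exchange_big /= mulr_sumr; apply: eq_bigr => t _.
    by rewrite -mulr_sumr mulrCA.
  rewrite /gap -ExpZ; apply: ler_Exp => w; rewrite outerE.
  rewrite mulrC -ler_pdivlMr // mulrC.
  apply: (fbar_jensen m.+1 (fun t => th' t.+1) (fun t => (st w t.+1).2)) => // t.
  rewrite ltnS leq_eqVlt => /orP[/eqP ->|]; last exact: th_ge0.
  by rewrite th_m exprn_ge0 // ltW.
have -> : sqdist s.+1 = D m.+1 by congr Exp; apply/funext => w; rewrite outer1.
rewrite -ThE => thA desc; move: jensen; rewrite thA; lra.
Qed.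

End OneEpoch.
End Epoch.

(** * The schedule *)

Section Recursions.
Context {R : realType}.
Implicit Types (G D U : nat -> R) (c e q a : R).

Lemma bernoulli_le (x : R) m : 0 <= x -> 1 + m%:R * x <= (1 + x) ^+ m.
Proof.
move=> x0; elim: m => [|m IH]; first by rewrite mul0r addr0 expr0.
have x1 : 0 <= 1 + x by rewrite addr_ge0.
rewrite exprS; apply: le_trans (ler_wpM2l x1 IH); rewrite mulrSr.
have : 0 <= m%:R * x * x by rewrite !mulr_ge0.
by move: (m%:R : R) => y; lra.
Qed.

Lemma doubling_recursion G D c e N :
  (forall s, (s < N)%N ->
     2 ^+ s * G s.+1 + c * D s.+1 <= 2 ^+ s / 2 * G s + 2 ^+ s * e + c * D s) ->
  forall s, (s <= N)%N ->
  2 ^+ s / 2 * G s + c * D s <= 1 / 2 * G 0%N + c * D 0%N + (2 ^+ s - 1) * e.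
Proof.
move=> rec; elim=> [|s IH] sN; first by rewrite expr0; lra.
have := IH (ltnW sN); have := rec s sN; rewrite exprS.
by move: (2 ^+ s : R) => y; lra.
Qed.

(** [b / (q - 1)] is the fixed point of the map sending [u] to [(u + b) / q]. *)
Lemma contraction_recursion U q b : 1 < q -> 0 <= b ->
  (forall k, q * U k.+1 <= U k + b) ->
  forall k, U k <= q ^- k * U 0%N + b / (q - 1).
Proof.
move=> q1 b0 rec; have q0 : 0 < q by apply: lt_trans q1.
have b1 : 0 <= b / (q - 1) by rewrite divr_ge0 // subr_ge0 ltW.
elim=> [|k IH]; first by rewrite expr0 invr1 mul1r lerDl.
rewrite -(ler_pM2l q0); apply: le_trans (rec k) _.
have -> : q * (q ^- k.+1 * U 0%N + b / (q - 1)) = q ^- k * U 0%N + b / (q - 1) + b.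
  by rewrite exprS; field; rewrite expf_neq0 !gt_eqF // subr_gt0.
by rewrite lerD2r.
Qed.

End Recursions.

(** * Properties of the parameter schedule *)

Section Schedule.
Context {R : realType}.
Variables (n : nat) (L tau : R).
Hypotheses (n_gt0 : (0 < n)%N) (L_gt0 : 0 < L) (tau_gt0 : 0 < tau).

Local Notation alp := (alpsch n L tau).
Local Notation gam := (gamsch n L tau).
Local Notation th := (thsch n L tau).
Local Notation s0 := (s0 n).

Let nR_gt0 : 0 < n%:R :> R. Proof. by rewrite ltr0n. Qed.

Lemma alpsch_gt0 s : 0 < alp s.
Proof.
rewrite /alpsch; case: ifP => _; first by rewrite divr_gt0.
by rewrite lt_min sqrtr_gt0 !divr_gt0 // !mulr_gt0.
Qed.

Lemma alpsch_half s : alp s <= 1 / 2.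
Proof. by rewrite /alpsch; case: ifP => _ //; rewrite ge_min lexx orbT. Qed.

Lemma gamsch_gt0 s : 0 < gam s.
Proof. by rewrite divr_gt0 // !mulr_gt0 // alpsch_gt0. Qed.

Lemma alp_gamsch s : 12 * L * alp s * gam s = 1.
Proof.
have := alpsch_gt0 s; rewrite /gamsch; move: (alp s) => a a0.
by rewrite mulrA mulr1 mulfV // gt_eqF // !mulr_gt0.
Qed.

Lemma Tsch_early s : (s.+1 <= s0)%N -> Tsch n s.+1 = (2 ^ s)%N.
Proof. by rewrite /Tsch => ->. Qed.

Lemma Tsch_late s : (s0 <= s)%N -> Tsch n s.+1 = (2 ^ s0.-1)%N.
Proof. by move=> ss0; rewrite /Tsch ltnNge ss0. Qed.

Lemma n_lt_s0 : (n < 2 ^ s0)%N.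
Proof. exact: trunc_log_ltn. Qed.

Lemma alpsch_late s : (s0 <= s)%N ->
  alp s.+1 = Num.min (Num.sqrt (n%:R * tau / (12 * L))) (1 / 2).
Proof. by move=> ss0; rewrite /alpsch ltnNge ss0. Qed.

Let ratio_ge0 : 0 <= n%:R * tau / (12 * L).
Proof. by rewrite divr_ge0 // ?mulr_ge0 // ltW. Qed.

Lemma alpsch_late_sq s : (s0 <= s)%N -> alp s.+1 ^+ 2 <= n%:R * tau / (12 * L).
Proof.
move=> ss0; rewrite -[leRHS](sqr_sqrtr ratio_ge0).
rewrite ler_pXn2r ?nnegrE ?sqrtr_ge0 //; last by rewrite ltW // alpsch_gt0.
by rewrite alpsch_late // ge_min lexx.
Qed.

(** By Bernoulli it suffices that the epoch length times [tau * gam s.+1] is at least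
    [alp s.+1 / 2]. The length is at least [n / 2], and [alp s.+1 <= n * tau * gam s.+1] follows
    from the bound on the square of [alp]. *)
Lemma epoch_growth s : (s0 <= s)%N ->
  1 + alp s.+1 / 2 <= (1 + tau * gam s.+1) ^+ Tsch n s.+1.
Proof.
move=> ss0; apply: le_trans (bernoulli_le _ _ _); last by rewrite mulr_ge0 ?ltW // gamsch_gt0.
rewrite lerD2l Tsch_late //.
have a0 := alpsch_gt0 s.+1; have g0 := gamsch_gt0 s.+1; have ag := alp_gamsch s.+1.
have a2 := alpsch_late_sq s ss0.
have nT : n%:R <= 2 * (2 ^ s0.-1)%:R :> R.
  by rewrite -natrM ler_nat -expnS; exact: ltnW n_lt_s0.
move: (alp _) (gam _) a0 g0 ag a2 => a g a0 g0 ag a2.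
have {}a2 : a <= n%:R * tau * g.
  rewrite -(ler_pM2l a0) -expr2; apply: le_trans a2 _.
  rewrite ler_pdivrMr ?mulr_gt0 //.
  rewrite (_ : a * _ * _ = n%:R * tau * (12 * L * a * g)); last by ring.
  by rewrite ag mulr1.
have tg : 0 < tau * g by rewrite mulr_gt0.
have := ler_wpM2r (ltW tg) nT; lra.
Qed.

Lemma thsch_early s t : (s.+1 <= s0)%N -> th s.+1 t = gam s.+1 / alp s.+1 * 1.
Proof.
move=> ss0; rewrite /thsch ss0 /psch (_ : alp s.+1 + 1 / 2 = 1).
  by case: ifP; rewrite ?mulr1.
by rewrite /alpsch ss0; field.
Qed.

Lemma thsch_late s t : (s0 <= s)%N -> (t.+1 < Tsch n s.+1)%N ->
  th s.+1 t.+1 = (1 + tau * gam s.+1) ^+ t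
    - (1 / 2 - alp s.+1) * (1 + tau * gam s.+1) ^+ t.+1.
Proof.
move=> ss0 tT; rewrite /thsch ltnNge ss0 /= tT /psch /=.
by congr (_ - _ * _); field.
Qed.

(** Reduces to [(1 / 2 - alp) * (1 + tau * gam) <= 1]. At [alp = 1 / 2] the product vanishes;
    otherwise [n * tau * gam = alp], so [tau * gam <= alp <= 1 / 2]. *)
Lemma thsch_late_ge0 s t : (s0 <= s)%N -> (t.+1 < Tsch n s.+1)%N -> 0 <= th s.+1 t.+1.
Proof.
move=> ss0 tT; set q := 1 + tau * gam s.+1.
have -> : th s.+1 t.+1 = (1 - (1 / 2 - alp s.+1) * q) * q ^+ t.
  by rewrite thsch_late // exprS -/q; ring.
rewrite {}/q.
have tg : 0 < tau * gam s.+1 by rewrite mulr_gt0 // gamsch_gt0.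
rewrite mulr_ge0 //; last by rewrite exprn_ge0 // addr_ge0 // ltW.
have ag := alp_gamsch s.+1; have g0 := gamsch_gt0 s.+1; have a0 := alpsch_gt0 s.+1.
have [a_half|a_lt] : alp s.+1 = 1 / 2 \/
    alp s.+1 ^+ 2 = n%:R * tau / (12 * L) /\ alp s.+1 <= 1 / 2.
- rewrite alpsch_late // minElt; case: ifP => h; last by left.
  by right; rewrite sqr_sqrtr // (ltW h).
- by rewrite a_half; lra.
case: a_lt => a2 a_half; have n1 : 1 <= n%:R :> R by rewrite ler1n.
have tg_a : tau * gam s.+1 <= alp s.+1.
  have e : n%:R * (tau * gam s.+1) = alp s.+1.
    apply: (mulfI (lt0r_neq0 a0)).
    by rewrite -expr2 a2 -[RHS]mulr1 -[X in _ = _ * X]ag; field; rewrite gt_eqF.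
  by rewrite -[leRHS]e ler_peMl // ltW.
move: (alp _) (tau * _) a0 a_half tg tg_a => a x a0 a_half tg tg_a; nra.
Qed.

Lemma thsch_last s : (s0 <= s)%N ->
  th s.+1 (Tsch n s.+1) = (1 + tau * gam s.+1) ^+ (Tsch n s.+1).-1.
Proof. by move=> ss0; rewrite /thsch ltnNge ss0 /= ltnn. Qed.

End Schedule.

(** * Convergence *)

Section Varag.
Context {R : realType} {d n : nat}.
Variables (f : nat -> 'rV[R]_d -> R) (L tau nu Z : R) (x0 z : 'rV[R]_d).
Hypotheses (n_gt0 : (0 < n)%N) (L_gt0 : 0 < L) (tau_gt0 : 0 < tau) (nu_gt0 : 0 < nu).
Hypothesis fA1 : forall i, (i < n)%N -> A1_comp L (f i).
Hypothesis F_sc : strongly_convex tau (fbar n f).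
Hypothesis z_min : forall x, fbar n f z <= fbar n f x.
Hypothesis xbar_Z : forall s t, (t <= Tsch n s.+1)%N ->
  Exp n (draws (Tsch n) s.+1)
    (fun w => enorm (zv_xbar n f nu L tau x0 w s.+1 t - z)) <= Z.
Hypothesis xlow_Z : forall s t, (1 <= t <= Tsch n s.+1)%N ->
  Exp n (draws (Tsch n) s.+1)
    (fun w => enorm (zv_xlow n f nu L tau x0 w s.+1 t - z)) <= Z.

Local Notation alp := (alpsch n L tau).
Local Notation gam := (gamsch n L tau).
Local Notation th := (thsch n L tau).
Local Notation s0 := (s0 n).
Local Notation gap := (@gap R d n f tau nu (Tsch n) gam alp th x0 z).
Local Notation sqdist := (@sqdist R d n f tau nu (Tsch n) gam alp th x0 z).

Let e := 3 / 4 * (nu ^+ 2 * L * d%:R) + 2 * (L * Num.sqrt d%:R * Z * nu).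
Let D0 := 2 * (fbar n f x0 - fbar n f z) + 6 * L * enorm (x0 - z) ^+ 2.

Lemma gap_ge0 s : 0 <= gap s.
Proof.
rewrite -(Exp_cst n n_gt0 (draws (Tsch n) s) 0).
by apply: ler_Exp => w; rewrite subr_ge0.
Qed.

Lemma e_ge0 : 0 <= e.
Proof.
have Z0 : 0 <= Z.
  apply: le_trans (xbar_Z 0 0 (leq0n _)).
  rewrite -[leLHS](Exp_cst n n_gt0 (draws (Tsch n) 1)).
  by apply: ler_Exp => // w; exact: enorm_ge0.
rewrite /e addr_ge0 // !mulr_ge0 ?invr_ge0 ?sqr_ge0 ?ler0n ?sqrtr_ge0 //; exact: ltW.
Qed.

Lemma D0_ge0 : 0 <= D0.
Proof.
apply: addr_ge0; apply: mulr_ge0; rewrite ?subr_ge0 ?sqr_ge0 //.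
by rewrite mulr_ge0 // ltW.
Qed.

Lemma early_descent s : (s < s0)%N ->
  2 ^+ s * gap s.+1 + 3 / 2 * L * sqdist s.+1 <=
  2 ^+ s / 2 * gap s + 2 ^+ s * e + 3 / 2 * L * sqdist s.
Proof.
move=> ss0; have a2 : alp s.+1 = 1 / 2 by rewrite /alpsch ss0.
have T0 : (0 < 2 ^ s)%N by rewrite expn_gt0.
have a0 := alpsch_gt0 n L tau n_gt0 L_gt0 tau_gt0 s.+1.
have g0 := gamsch_gt0 n L tau n_gt0 L_gt0 tau_gt0 s.+1.
(* With [alp = 1 / 2] the coefficient [r] vanishes and all weights coincide, which forces [q = 1]:
   early epochs give up the strong convexity growth. *)
have := epoch_descent f L tau nu Z n_gt0 L_gt0 (ltW tau_gt0) nu_gt0 fA1 F_sc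
  (Tsch n) gam alp th x0 z s a0 (alpsch_half _ _ _ _) g0
  (alp_gamsch _ _ _ n_gt0 L_gt0 tau_gt0 _) (xbar_Z s) (xlow_Z s)
  1 (gam s.+1 / alp s.+1) (fun=> 1) (2 ^ s).-1 ltr01.
rewrite lerDl mulr_ge0 ?(ltW g0) ?(ltW tau_gt0) // divr_gt0 // a2.
rewrite Tsch_early // prednK // => /(_ isT isT erefl).
have thE t : th s.+1 t = gam s.+1 / (1 / 2) * 1 by rewrite thsch_early // a2.
have rE : 1 / 2 - 1 / 2 = 0 :> R by rewrite subrr.
move=> /(_ thE); rewrite rE expr1n => h.
have {h} := h (fun t _ => _) (fun _ _ => ler01) erefl; rewrite -/e.
have SE : \sum_(t < 2 ^ s) 1 ^+ t = 2 ^+ s :> R.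
  under eq_bigr => t _ do rewrite expr1n.
  by rewrite sumr_const card_ord natrX.
have c_eq : 6 * L * (1 / 2) ^+ 2 = 3 / 2 * L by field.
have one_eq t : 1 = 1 ^+ t - 0 * 1 ^+ t.+1 :> R by rewrite !expr1n mul0r subr0.
move=> /(_ one_eq); cbv zeta; rewrite SE c_eq expr1n !addr0 mulr1.
by move: (2 ^+ s : R) => y; lra.
Qed.

Lemma early_gap s : (s <= s0)%N ->
  2 ^+ s / 2 * gap s + 3 / 2 * L * sqdist s <= D0 / 4 + (2 ^+ s - 1) * e.
Proof.
move=> ss0; apply: le_trans (doubling_recursion _ _ _ _ _ early_descent _ ss0) _.
rewrite lerD2r.
have -> : gap 0 = fbar n f x0 - fbar n f z.
  exact: (Exp_cst n n_gt0 (draws (Tsch n) 0) (fbar n f x0 - fbar n f z)).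
have -> : sqdist 0 = enorm (x0 - z) ^+ 2.
  exact: (Exp_cst n n_gt0 (draws (Tsch n) 0) (enorm (x0 - z) ^+ 2)).
by rewrite /D0; lra.
Qed.

Let a := alp s0.+1.
Let q := 1 + tau * gam s0.+1.
Let S := \sum_(t < 2 ^ s0.-1) q ^+ t.
(** [C] and [c] weight the gap and the squared distance in the potential that contracts over late
    epochs. *)
Let C := 1 / 2 * S + (1 / 2 - a).
Let c := 6 * L * a ^+ 2.

Let a_gt0 : 0 < a. Proof. exact: alpsch_gt0. Qed.
Let a_half : a <= 1 / 2. Proof. exact: alpsch_half. Qed.
Let T_gt0 : (0 < 2 ^ s0.-1)%N. Proof. by rewrite expn_gt0. Qed.
Let q_ge1 : 1 <= q.
Proof. by rewrite /q lerDl mulr_ge0 // ltW // gamsch_gt0. Qed.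

Let S_geT : 2 ^+ s0.-1 <= S.
Proof.
rewrite -natrX -[X in X%:R]card_ord -sumr_const.
by apply: ler_sum => t _; exact: exprn_ege1.
Qed.

Let S_ge1 : 1 <= S.
Proof. by apply: le_trans S_geT; rewrite -natrX ler1n. Qed.

Lemma late_descent s : (s0 <= s)%N ->
  (1 + a / 2) * (C * gap s.+1 + c * sqdist s.+1) <=
  C * gap s + c * sqdist s + S * e.
Proof.
move=> ss0; have aE : alp s.+1 = a by rewrite /a !alpsch_late.
have gE : gam s.+1 = gam s0.+1 by rewrite /gamsch aE.
have TE : Tsch n s.+1 = (2 ^ s0.-1).-1.+1 by rewrite Tsch_late // prednK.
have := epoch_descent f L tau nu Z n_gt0 L_gt0 (ltW tau_gt0) nu_gt0 fA1 F_sc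
  (Tsch n) gam alp th x0 z s (alpsch_gt0 _ _ _ n_gt0 L_gt0 tau_gt0 _)
  (alpsch_half _ _ _ _) (gamsch_gt0 _ _ _ n_gt0 L_gt0 tau_gt0 _)
  (alp_gamsch _ _ _ n_gt0 L_gt0 tau_gt0 _) (xbar_Z s) (xlow_Z s)
  (1 + tau * gam s.+1) 1 (th s.+1) (2 ^ s0.-1).-1.
have q0 : 0 < 1 + tau * gam s.+1 by rewrite gE; apply: lt_le_trans q_ge1.
have th_lt t : (t < (2 ^ s0.-1).-1)%N -> (t.+1 < Tsch n s.+1)%N by rewrite TE ltnS.
move=> /(_ q0 (lexx _) ltr01 TE (fun t => esym (mul1r _))).
move=> /(_ (fun t tT => thsch_late _ _ _ _ _ ss0 (th_lt t tT))).
move=> /(_ (fun t tT => thsch_late_ge0 _ _ _ n_gt0 L_gt0 tau_gt0 _ _ ss0 (th_lt t tT))).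
have th_m : th s.+1 (2 ^ s0.-1).-1.+1 = (1 + tau * gam s.+1) ^+ (2 ^ s0.-1).-1.
  by rewrite -TE thsch_last // TE.
move=> /(_ th_m); cbv zeta; rewrite prednK // aE gE -/q -/S -/c -/e.
have growth : 1 + a / 2 <= q ^+ (2 ^ s0.-1).
  by have := epoch_growth _ _ _ n_gt0 L_gt0 tau_gt0 _ (leqnn s0); rewrite Tsch_late.
have coef : (1 + a / 2) * C <= (1 / 2 + a) * S + (1 / 2 - a).
  rewrite /C; move: a S a_gt0 a_half S_ge1 => a' S' a1 a2 S1; nra.
have h1 := ler_wpM2r (gap_ge0 s.+1) coef.
have c0 : 0 <= c by rewrite !mulr_ge0 ?sqr_ge0 // ltW.
have cd : 0 <= c * sqdist s.+1 by rewrite mulr_ge0 // sqdist_ge0.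
have h2 := ler_wpM2r cd growth.
rewrite -/C; move: (q ^+ _) h1 h2 => qT h1 h2.
move: (gap s) (gap s.+1) (sqdist s) (sqdist s.+1) h1 h2 => G G' D D' h1 h2.
clearbody C S a c e; lra.
Qed.

(** The contraction starts from the state reached after the doubling epochs. Dividing the potential
    by [C] turns the accumulated error into a multiple of [e / a], since [S <= 2 * C]. *)
Lemma late_gap k : gap (s0 + k) <=
  (1 + a / 2) ^- k * (D0 / n%:R) + (1 + a^-1) * (3 * (nu ^+ 2 * L * d%:R)
    + 8 * (L * Num.sqrt d%:R * Z * nu)).
Proof.
have e0 := e_ge0; have d0 := D0_ge0.
pose U k := C * gap (s0 + k) + c * sqdist (s0 + k).
have rho1 : 1 < 1 + a / 2 by rewrite ltrDl divr_gt0.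
have Se0 : 0 <= S * e by rewrite mulr_ge0 // (le_trans ler01).
have rec k' : (1 + a / 2) * U k'.+1 <= U k' + S * e.
  by rewrite /U addnS; apply: late_descent; rewrite leq_addr.
have := contraction_recursion _ _ _ rho1 Se0 rec k.
rewrite {1 2}/U addn0 => Uk.
have -> : 3 * (nu ^+ 2 * L * d%:R) + 8 * (L * Num.sqrt d%:R * Z * nu) = 4 * e.
  by rewrite /e; field.
pose T : R := 2 ^+ s0.-1.
have T0 : 0 < T by rewrite exprn_gt0.
have SC : S <= 2 * C by rewrite /C; have := a_half; clearbody a S; lra.
have C0 : 0 < C by have := S_ge1; clearbody C S; lra.
have nT : n%:R <= 2 * T.
  by rewrite /T -exprS -natrX ler_nat; exact: ltnW (n_lt_s0 n).
have n0 : 0 < n%:R :> R by rewrite ltr0n.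
have Dd0 := sqdist_ge0 f tau nu n_gt0 (Tsch n) gam alp th x0 z s0.
(* Twice the early estimate, with one of the two [T * gap s0] discarded: this raises the weight of
   the distance to [3 * L], while [n <= 2 * T] turns [D0 / 2] into at most [T * (D0 / n)]. *)
have start : gap s0 + 3 * L / T * sqdist s0 <= D0 / n%:R + 4 * e.
  rewrite -(ler_pM2l T0).
  have -> : T * (gap s0 + 3 * L / T * sqdist s0) = T * gap s0 + 3 * L * sqdist s0.
    by field; rewrite gt_eqF.
  have := early_gap _ (leqnn s0).
  have -> : 2 ^+ s0 / 2 = T by rewrite exprS /T; field.
  have -> : 2 ^+ s0 = 2 * T by rewrite exprS.
  have Tg : 0 <= T * gap s0 by rewrite mulr_ge0 ?gap_ge0 // ltW.
  have Dn : D0 / 2 <= T * (D0 / n%:R).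
    rewrite mulrA ler_pdivlMr // mulrAC ler_pdivrMr // -mulrA [T * _]mulrC -mulrA.
    by rewrite ler_wpM2l // [T * 2]mulrC.
  move: (gap s0) (sqdist s0) (D0 / n%:R) Tg Dn => G D r Tg Dn; clearbody e T D0; lra.
(* The distance term of the initial potential fits under [start], because [a <= 1 / 2] and
   [T <= 2 * C]. *)
have c_le : c <= C * (3 * L / T).
  have TC : T <= 2 * C by apply: le_trans SC.
  rewrite mulrA ler_pdivlMr // /c.
  have a2 : a ^+ 2 <= 1 / 4.
    rewrite (_ : 1 / 4 = (1 / 2) ^+ 2); last by field.
    by rewrite ler_pXn2r ?nnegrE ?(ltW a_gt0).
  apply: (@le_trans _ _ (6 * L * (1 / 4) * (2 * C))); last lra.
  apply: ler_pM; rewrite ?mulr_ge0 ?sqr_ge0 ?(ltW L_gt0) ?(ltW T0) ?(ltW a_gt0) //.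
  by apply: ler_wpM2l => //; rewrite mulr_ge0 // ltW.
have U0 : C * gap s0 + c * sqdist s0 <= C * (D0 / n%:R + 4 * e).
  apply: le_trans (ler_wpM2l (ltW C0) start).
  by rewrite mulrDr lerD2l [leRHS]mulrA ler_wpM2r.
have rk0 : 0 <= (1 + a / 2) ^- k by rewrite invr_ge0 exprn_ge0 // ltW // (lt_trans ltr01).
have rk1 : (1 + a / 2) ^- k <= 1.
  by rewrite invf_le1 ?exprn_gt0 ?exprn_ege1 ?(ltW rho1) // (lt_trans ltr01).
have tail : S * e / (1 + a / 2 - 1) <= C * (a^-1 * (4 * e)).
  have -> : S * e / (1 + a / 2 - 1) = S * (a^-1 * (2 * e)).
    by field; rewrite gt_eqF //= addrC addKr mulf_neq0 ?invr_eq0 ?gt_eqF.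
  have -> : C * (a^-1 * (4 * e)) = 2 * C * (a^-1 * (2 * e)) by ring.
  by rewrite ler_wpM2r // !mulr_ge0 // invr_ge0 ltW.
have cD : 0 <= c * sqdist (s0 + k).
  rewrite mulr_ge0 ?sqdist_ge0 // /c !mulr_ge0 ?sqr_ge0 //; exact: ltW.
rewrite -(ler_pM2l C0).
have h1 := ler_wpM2l rk0 U0.
have h2 : (1 + a / 2) ^- k * (C * (4 * e)) <= C * (4 * e).
  by rewrite -[leRHS]mul1r ler_wpM2r // !mulr_ge0 // ltW.
move: ((1 + a / 2) ^- k) (a^-1) (D0 / n%:R) (gap s0) (sqdist s0) h1 h2 tail Uk.
move=> r ai Dn G0 d0' h1 h2 tail Uk.
move: (S * e / _) (gap (s0 + k)) (c * sqdist _) tail Uk cD => tl Gk cDk tail Uk cD.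
clearbody e C; lra.
Qed.

Lemma early_rate s : (s <= s0)%N -> gap s <= D0 / 2 ^+ s.+1
  + 3 / 2 * (nu ^+ 2 * L * d%:R) + 4 * (L * Num.sqrt d%:R * Z * nu).
Proof.
move=> ss0; have := early_gap _ ss0.
have Dd := sqdist_ge0 f tau nu n_gt0 (Tsch n) gam alp th x0 z s.
have LD : 0 <= 3 / 2 * L * sqdist s by rewrite mulr_ge0 // mulr_ge0 ?divr_ge0 // ltW.
have p0 : 0 < 2 ^+ s / 2 :> R by rewrite divr_gt0 // exprn_gt0.
have e0 := e_ge0; move=> h; rewrite -addrA.
have -> : 3 / 2 * (nu ^+ 2 * L * d%:R) + 4 * (L * Num.sqrt d%:R * Z * nu) = 2 * e.
  by rewrite /e; field.
rewrite -(ler_pM2l p0).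
have -> : 2 ^+ s / 2 * (D0 / 2 ^+ s.+1 + 2 * e) = D0 / 4 + 2 ^+ s * e.
  by rewrite exprS; field; rewrite expf_neq0.
move: h LD; move: (2 ^+ s : R) (3 / 2 * L * _) => y w h LD; clearbody e D0; lra.
Qed.

End Varag.

Theorem theorem8 (R : realType) (d n : nat) (f : nat -> 'rV[R]_d -> R)
  (L tau nu Z : R) (x0 xstar : 'rV[R]_d) :
  (0 < n)%N -> 0 < L -> 0 < tau -> 0 < nu ->
  (* (A1) *)
  (forall i, (i < n)%N -> A1_comp L (f i)) ->
  (* (A3) *)
  strongly_convex tau (fbar n f) ->
  (* xstar is the minimizer of f, f^* = f xstar *)
  (forall x, fbar n f xstar <= fbar n f x) ->
  (* (A2_nu): expected distances of the inner iterates to xstar bounded by Z *)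
  (forall s, (1 <= s)%N ->
     (forall t, (t <= Tsch n s)%N ->
        Exp n (draws (Tsch n) s)
          (fun w => enorm (zv_xbar n f nu L tau x0 w s t - xstar)) <= Z) /\
     (forall t, (1 <= t <= Tsch n s)%N ->
        Exp n (draws (Tsch n) s)
          (fun w => enorm (zv_xlow n f nu L tau x0 w s t - xstar)) <= Z)) ->
  let vs1 := nu ^+ 2 * L * d%:R in
  let vs2 := L * Num.sqrt d%:R * Z * nu in
  let D0 := 2 * (fbar n f x0 - fbar n f xstar) + 6 * L * enorm (x0 - xstar) ^+ 2 in
  forall s, (1 <= s)%N ->
  Exp n (draws (Tsch n) s)
      (fun w => fbar n f (zv_outer n f nu L tau x0 w s).2 - fbar n f xstar)
  <= (if (s <= s0 n)%N then
        D0 / 2 ^+ s.+1 + 3 / 2 * vs1 + 4 * vs2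
      else if 3 * L / tau <= n%:R then
        (4 / 5) ^+ (s - s0 n) * (D0 / n%:R) + 9 * vs1 + 24 * vs2
      else
        (1 + 1 / 4 * Num.sqrt (n%:R * tau / (3 * L))) ^- (s - s0 n) * (D0 / n%:R)
        + (2 * Num.sqrt (3 * L / (n%:R * tau)) + 1) * (3 * vs1 + 8 * vs2)).
Proof.
move=> n_gt0 L_gt0 tau_gt0 nu_gt0 fA1 F_sc z_min A2 vs1 vs2 D0 s _.
have xbar_Z s' := (A2 s'.+1 isT).1; have xlow_Z s' := (A2 s'.+1 isT).2.
have [ss0|ss0] := leqP s (s0 n).
  exact: (early_rate f L tau nu Z x0 xstar).
have n0 : 0 < n%:R :> R by rewrite ltr0n.
have := late_gap f L tau nu Z x0 xstar n_gt0 L_gt0 tau_gt0 nu_gt0 fA1 F_sc z_min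
  xbar_Z xlow_Z (s - s0 n).
rewrite (subnKC (ltnW ss0)) -/vs1 -/vs2 -/D0 alpsch_late // => main.
have sq4 : n%:R * tau / (3 * L) = 2 ^+ 2 * (n%:R * tau / (12 * L)) :> R.
  by field; rewrite gt_eqF.
have r0 : 0 <= n%:R * tau / (12 * L) :> R by rewrite divr_ge0 // mulr_ge0 // ltW.
have half_sq : Num.sqrt (1 / 4) = 1 / 2 :> R.
  by rewrite (_ : 1 / 4 = (1 / 2) ^+ 2) ?sqrtr_sqr ?ger0_norm //; field.
(* The threshold [3 * L / tau] is where the square root in [alp] reaches 1/2. Above it [a = 1 / 2],
   so [1 + a / 2 = 5 / 4] and [1 + a^-1 = 3]; below it [a] is the square root, half of the one in
   the stated rate. *)
case: (leP (3 * L / tau) n%:R) => [n_ge|n_lt].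
  have le_half : 1 / 2 <= Num.sqrt (n%:R * tau / (12 * L)) :> R.
    rewrite -half_sq ler_wsqrtr // ler_pdivlMr ?mulr_gt0 //.
    by move: n_ge; rewrite ler_pdivrMr //; lra.
  rewrite (min_idPr le_half) in main; apply: le_trans main _.
  have -> : (1 + 1 / 2 / 2) ^- (s - s0 n) = (4 / 5) ^+ (s - s0 n) :> R.
    by rewrite -exprVn; congr (_ ^+ _); field.
  by rewrite -addrA lerD2l le_eqVlt; apply/orP; left; apply/eqP; field.
have lt_half : Num.sqrt (n%:R * tau / (12 * L)) <= 1 / 2 :> R.
  rewrite -half_sq ler_wsqrtr // ler_pdivrMr ?mulr_gt0 //.
  by move: n_lt; rewrite ltr_pdivlMr //; lra.
rewrite (min_idPl lt_half) in main; apply: le_trans main _.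
have -> : Num.sqrt (n%:R * tau / (3 * L)) = 2 * Num.sqrt (n%:R * tau / (12 * L)) :> R.
  by rewrite sq4 sqrtrM ?sqr_ge0 // sqrtr_sqr ger0_norm.
have -> : 2 * Num.sqrt (3 * L / (n%:R * tau)) = (Num.sqrt (n%:R * tau / (12 * L)))^-1 :> R.
  rewrite -sqrtrV // -[2 in LHS]ger0_norm // -sqrtr_sqr -sqrtrM ?sqr_ge0 //.
  by congr Num.sqrt; field; rewrite !gt_eqF.
rewrite le_eqVlt; apply/orP; left; apply/eqP; congr (_ ^- _ * _ + _ * _); first by field.
by rewrite addrC.
Qed.
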